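(* Let $\Gamma$ be a countable discrete sofic group acting by homeomorphisms on a compact metrizable space $X$. For any sofic approximation $\Sigma$ of $\Gamma$ and $1\le p\le q\le\infty$ we have $$\operatorname{mdim}_\Sigma(X,\Gamma)\le\operatorname{mdim}_{\Sigma,M,p}(X,\Gamma)\le\operatorname{mdim}_{\Sigma,M,q}(X,\Gamma).$$
   Context: A sofic approximation of $\Gamma$ is a sequence $\Sigma$ of maps $\sigma_i\colon\Gamma\to S_{d_i}$ with $d_i\to\infty$ such that $\frac{1}{d_i}|\{k:\sigma_i(g)\sigma_i(h)(k)=\sigma_i(gh)(k)\}|\to1$ for all $g,h$ and $\frac{1}{d_i}|\{k:\sigma_i(g)(k)\neq\sigma_i(h)(k)\}|\to1$ for all $g\ne h$. $\Gamma$ is sofic if it has one. For a pseudometric $\rho$ on $X$, on $X^k$ let $\rho_p(x,y)=(\frac1k\sum_{j=1}^k\rho(x_j,y_j)^p)^{1/p}$ for $p<\infty$ and $\rho_\infty(x,y)=\max_j\rho(x_j,y_j)$. A continuous pseudometric $\rho$ on $X$ is dynamically generating if for all $x\ne y$ there is $g\in\Gamma$ with $\rho(gx,gy)>0$. For $F\subseteq\Gamma$ finite and $\delta>0$, $\mathrm{Map}(\rho,F,\delta,\sigma_i)$ is the set of maps $\phi\colon\{1,\dots,d_i\}\to X$ with $\rho_2(\phi\circ\sigma_i(g),g\phi)<\delta$ for all $g\in F$. Metric mean dimensions: $S_\varepsilon(Y,d)$ is the smallest cardinality of an $\varepsilon$-dense subset of $(Y,d)$; $$\operatorname{mdim}_{\Sigma,p}(X,\rho)=\liminf_{\varepsilon\to0}\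 \inf_{F,\delta}\ \limsup_{i\to\infty}\frac{\log S_\varepsilon(\mathrm{Map}(\rho,F,\delta,\sigma_i),\rho_p)}{d_i\log(1/\varepsilon)},\qquad \operatorname{mdim}_{\Sigma,M,p}(X,\Gamma)=\inf_\rho\operatorname{mdim}_{\Sigma,p}(X,\rho),$$ the infimum $\inf_\rho$ being over all dynamically generating continuous pseudometrics. Mean dimension: for a metrizable space $Y$ with a continuous pseudometric $d$, $\operatorname{wdim}_\varepsilon(Y,d)$ is the smallest $k$ such that there are a compact metrizable space $K$ of covering dimension $k$ and a continuous map $f\colon Y\to K$ such that $d(x,y)<\varepsilon$ whenever $f(x)=f(y)$. For a dynamically generating continuous pseudometric $\rho$ and a compatible metric $\rho'$ on $X$, $$\operatorname{mdim}_\Sigma(X,\Gamma)=\sup_{\varepsilon>0}\ \inf_{F,\delta}\ \limsup_{i\to\infty}\frac{\operatorname{wdim}_\varepsilon(\mathrm{Map}(\rho,F,\delta,\sigma_i),\rho'_\infty)}{d_i};$$ this does not depend on the choice of $\rho,\rho'$ (known result of Li). All infima $\inf_{F,\delta}$ are over finite $F\subseteq\Gamma$ and $\delta>0$. *)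

(* Defs.v *)
From HB Require Import structures.
From mathcomp Require Import all_boot all_order all_algebra perm.
From mathcomp Require Import all_classical all_reals all_analysis.

Set Implicit Arguments.
Unset Strict Implicit.
Unset Printing Implicit Defensive.

Import Order.TTheory GRing.Theory Num.Theory.
Import numFieldNormedType.Exports.

Local Open Scope classical_set_scope.
Local Open Scope ring_scope.

Section Pseudometrics.
Context {R : realType}.

Definition pseudometric (Y : Type) (rho : Y -> Y -> R) : Prop :=
  [/\ forall x y, 0 <= rho x y,
      forall x, rho x x = 0,
      forall x y, rho x y = rho y x
    & forall x y z, rho x z <= rho x y + rho y z].

Definition continuous_pseudometric (Y : topologicalType) (rho : Y -> Y -> R) :
    Prop :=
  pseudometric rho /\ continuous (fun xy : Y * Y => rho xy.1 xy.2).

Definition compatible_metric (Y : topologicalType) (rho : Y -> Y -> R) : Prop :=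
  [/\ pseudometric rho,
      forall x y, rho x y = 0 -> x = y
    & forall (x : Y) (A : set Y),
        nbhs x A <-> exists2 e : R, 0 < e & [set y | rho x y < e] `<=` A].

(* The pseudometric rho_p on X^k, for 1 <= p <= +oo; the value at p = -oo is
   irrelevant. *)
Definition power_dist (X : Type) (p : \bar R) (rho : X -> X -> R) (k : nat)
    (x y : 'I_k -> X) : R :=
  match p with
  | r%:E => (k%:R^-1 * \sum_(j < k) (rho (x j) (y j)) `^ r) `^ r^-1
  | +oo%E => \big[Num.max/0]_(j < k) rho (x j) (y j)
  | -oo%E => 0
  end.

(* The smallest cardinality of an eps-dense subset of (Y, dist), and +oo if
   there is no finite one; it is 0 when Y is empty. *)
Definition spanning_number (T : Type) (Y : set T) (dist : T -> T -> R)
    (eps : R) : \bar R :=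
  ereal_inf [set n%:R%:E | n in [set n : nat | exists A : set T,
    [/\ A `<=` Y, (A #= `I_n)%card
      & forall y, Y y -> exists2 a, A a & dist y a < eps]]].

End Pseudometrics.

Arguments power_dist {R X} p rho {k} x y.

Definition metrizable (R : realType) (Y : topologicalType) : Prop :=
  exists rho : Y -> Y -> R, compatible_metric rho.

Definition open_cover (K : topologicalType) (U : set (set K)) : Prop :=
  (forall A, U A -> open A) /\ \bigcup_(A in U) A = [set: K].

Definition covering_dim_le (K : topologicalType) (n : nat) : Prop :=
  forall U : set (set K), finite_set U -> open_cover U ->
  exists V : set (set K),
    [/\ finite_set V, open_cover V,
        forall B, V B -> exists2 A, U A & B `<=` A
      & forall x : K, ([set B | V B /\ B x] #<= `I_n.+1)%card].

(* Convention: the empty space has dimension -oo. *)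
Definition covering_dim (R : realType) (K : topologicalType) : \bar R :=
  if `[< [set: K] = set0 >] then -oo%E
  else ereal_inf [set n%:R%:E | n in [set n | covering_dim_le K n]].

(* With the above convention wdim is -oo on the empty space, and it is a
   natural number or +oo on a nonempty one. *)
Definition wdim (R : realType) (Y : topologicalType) (dist : Y -> Y -> R)
    (eps : R) : \bar R :=
  ereal_inf [set k : \bar R | exists K : topologicalType,
    [/\ compact [set: K], metrizable R K, covering_dim R K = k
      & exists2 f : Y -> K, continuous f
          & forall x y, f x = f y -> dist x y < eps]].

(* Each act g is a homeomorphism, its inverse being act g^-1. *)
Definition action_by_homeos (G : groupType) (X : topologicalType)
    (act : G -> X -> X) : Prop :=
  [/\ forall x, act 1%g x = x,
      forall g h x, act (g * h)%g x = act g (act h x)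
    & forall g, continuous (act g)].

(* sigma i g (sigma i h k) is spelled out because the product of 'S_n is
   (s * t) k = t (s k). *)
Definition sofic_approximation (R : realType) (G : groupType) (d : nat -> nat)
    (sigma : forall i, G -> 'S_(d i)) : Prop :=
  [/\ d @ \oo --> \oo,
      forall g h,
        (#|[set k : 'I_(d i) |
              sigma i g (sigma i h k) == sigma i (g * h)%g k]%SET|%:R
          / (d i)%:R : R) @[i --> \oo] --> (1 : R)
    & forall g h, g <> h ->
        (#|[set k : 'I_(d i) | sigma i g k != sigma i h k]%SET|%:R
          / (d i)%:R : R) @[i --> \oo] --> (1 : R)].

Definition sofic (R : realType) (G : groupType) : Prop :=
  exists (d : nat -> nat) (sigma : forall i, G -> 'S_(d i)),
    sofic_approximation R sigma.

Section MeanDimension.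
Context {R : realType} {G : groupType} {X : topologicalType}.
Variable act : G -> X -> X.

Definition dyn_generating (rho : X -> X -> R) : Prop :=
  continuous_pseudometric rho /\
  (forall x y : X, x <> y -> exists g, 0 < rho (act g x) (act g y)).

Definition Map (rho : X -> X -> R) (F : set G) (delta : R) (n : nat)
    (s : G -> 'S_n) : set {ptws 'I_n -> X} :=
  [set phi | forall g, F g ->
    power_dist 2%:E rho (fun k => phi (s g k)) (fun k => act g (phi k))
      < delta].

Variables (d : nat -> nat) (sigma : forall i, G -> 'S_(d i)).

Definition inf_Fdelta (u : set G -> R -> \bar R) : \bar R :=
  ereal_inf [set u Fd.1 Fd.2 | Fd in
    [set Fd : set G * R | finite_set Fd.1 /\ 0 < Fd.2]].

Definition mdim_metric (p : \bar R) (rho : X -> X -> R) : \bar R :=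
  limf_einf (fun eps : R => inf_Fdelta (fun F delta =>
    limn_esup (fun i =>
      lne (spanning_number (Map rho F delta (sigma i))
             (power_dist p rho) eps)
      * ((d i)%:R * ln eps^-1)^-1%:E)%E)) (0 : R)^'+.

Definition mdim_M (p : \bar R) : \bar R :=
  ereal_inf [set mdim_metric p rho | rho in [set rho | dyn_generating rho]].

(* Computed with a dynamically generating pseudometric rho and a compatible
   metric rho'; Map carries the topology induced from the product. *)
Definition mdim (rho rho' : X -> X -> R) : \bar R :=
  ereal_sup [set inf_Fdelta (fun F delta =>
    limn_esup (fun i =>
      wdim (fun x y : set_type (Map rho F delta (sigma i)) =>
              power_dist +oo%E rho' (set_val x) (set_val y)) eps
      * ((d i)%:R)^-1%:E)%E) | eps in [set eps : R | 0 < eps]].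

End MeanDimension.

(* Main.v *)
Require Import Defs.
From HB Require Import structures.
From mathcomp Require Import all_boot all_order all_algebra perm.
From mathcomp Require Import all_classical all_reals all_analysis.
From mathcomp Require Import ring lra.

Set Implicit Arguments.
Unset Strict Implicit.
Unset Printing Implicit Defensive.

Import Order.TTheory GRing.Theory Num.Theory.
Import numFieldNormedType.Exports.

Local Open Scope classical_set_scope.
Local Open Scope ring_scope.

(** The second inequality is the monotonicity of power means: [rho_p <= rho_q]
    when [p <= q] ([power_dist_le]), so a set that is eps-dense for [rho_q] is
    eps-dense for [rho_p], and every operation in the definition of the metric
    mean dimension is monotone.  It reduces the first inequality to [p = 1],
    for an arbitrary dynamically generating pseudometric [rho2] on the metric
    side ([mdim_le_mdim_metric1]).

    Fix [eps0 > 0].  By compactness there are finitely many bump functions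
    [w_a : X -> [0, 1]], Lipschitz for [sum_(g in E) rho2 (g x) (g y)] with [E]
    finite, such that every [x] has some [w_a x = 1], and
    [w_a x = 1], [w_a y > 0] force [rho' x y < eps0] ([separating_bumps]).
    They embed [Map], up to eps0, in a cube [[0, 1]^I] with
    [I = {1..l} * {1..d_i}].  Points of [Map] are almost equivariant and
    [sigma_i g] is a permutation, so two of them that are close in the average
    of [rho2] have images close in the average over [I] ([Map_sum_dist]): the
    image of [Map] is covered by as many small l^1-balls as [Map] has points
    in an eps-dense set.

    Cut [[0, 1]] into [Q ~ 1/eps] cells and pick a cell for each coordinate.
    Collapsing to [0] or [1] whatever lies below or above the chosen cell sends
    the image of [Map] to the points of the cube with few coordinates outside
    [{0, 1}], that is, to a skeleton, and it keeps the values [0] and [1], which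
    are all that is needed to separate points eps0-apart.  A point in an l^1-ball
    can have a coordinate inside its chosen cell only where the centre of the
    ball is close to that cell, or where point and centre are far apart; by
    Markov's inequality the second case concerns few coordinates
    ([card_frac_coords]).  For cells picked at random, a given centre is close to
    [m] of them with probability at most [2^|I| (B/Q)^m], so the union bound over
    the centres gives a good choice as soon as their number is below
    [2^(-|I|) (Q/B)^m] ([exists_sparse_cells]).  With [eps^(-D d_i)] centres,
    [m] slightly above [D d_i] is enough when eps is small, whence
    [wdim <= (D + o(1)) d_i].

    A k-dimensional skeleton has covering dimension at most [k]
    ([skeleton_dim]).  Finally [Map] for [rho] is eventually contained in [Map]
    for [rho2] with other parameters ([Map_transfer]), because each of the two
    pseudometrics is controlled by finitely many translates of the other. *)

(** * Covering dimension of a skeleton of the cube *)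

Lemma lebesgue_number (R : realType) (K : pseudoMetricType R)
    (U : set (set K)) :
  compact [set: K] -> open_cover U ->
  exists2 e : R, 0 < e & forall x, exists2 A, U A & ball x e `<=` A.
Proof.
move=> /compact_near_coveringP cK [oU cU].
have /cK : forall x : K, [set: K] x ->
    \forall x' \near x & e \near (0 : R)^'+, exists2 A, U A & ball x' e `<=` A.
  move=> x _; have [A UA Ax] : (\bigcup_(A in U) A) x by rewrite cU.
  have /nbhs_ballP[r /= r0 rA] : nbhs x A.
    by apply: open_nbhs_nbhs; split => //; exact: oU.
  exists (ball x (r / 2), [set e | e < r / 2]) => /=.
    split; first by apply: nbhsx_ballx; lra.
    by apply: nbhs_right_lt; lra.
  move=> [x' e] /= [xx' er]; exists A => // y x'y; apply: rA.
  rewrite (splitr r); apply: ball_triangle xx' _.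
  exact: le_ball (ltW er) _ x'y.
rewrite near_withinE => H.
have [e [e0 He]] : exists e : R, 0 < e /\
    [set: K] `<=` (fun x' => exists2 A, U A & ball x' e `<=` A).
  apply: (@filter_ex _ (0 : R)^'+); near=> e; split.
    by near: e; exact: nbhs_right_gt.
  by near: e.
by exists e => // x; exact: He.
Unshelve. all: by end_near. Qed.

(** A cover whose members carry [k + 1] colours, two members of the same colour
    being disjoint, has order at most [k + 1]: a point lies in at most one member
    of each colour. *)
Lemma covering_dim_le_colored (R : realType) (K : pseudoMetricType R)
    (k : nat) :
  compact [set: K] ->
  (forall e : R, 0 < e ->
     exists (L : finType) (V : 'I_k.+1 -> L -> set K),
     [/\ forall j l, open (V j l),
         forall x, exists j l, V j l x,
         forall j l l' x, V j l x -> V j l' x -> l = l'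
       & forall j l x y, V j l x -> V j l y -> ball x e y]) ->
  covering_dim_le K k.
Proof.
move=> cK H U _ oU; have [e e0 eU] := lebesgue_number cK oU.
have [L [V [oV cV dV bV]]] := H e e0.
exists [set V jl.1 jl.2 | jl in [set jl : 'I_k.+1 * L | V jl.1 jl.2 !=set0]].
split.
- exact/finite_image/finite_finset.
- split; first by move=> _ [jl _ <-]; exact: oV.
  rewrite -subTset => x _; have [j [l Vx]] := cV x.
  by exists (V j l) => //; exists (j, l) => //=; exists x.
- move=> _ [[j l] /= [x Vx] <-]; have [A UA xA] := eU x.
  by exists A => // y Vy; apply/xA/(bV _ _ _ _ Vx).
- move=> x.
  pose color B := xget ord0 [set j | exists l, B = V j l /\ V j l x].
  have colorP B : (exists j l, B = V j l /\ V j l x) ->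
      exists l, B = V (color B) l /\ V (color B) l x.
    move=> ex; rewrite /color.
    exact: (@xgetPex _ _ [set j | exists l, B = V j l /\ V j l x]).
  have colorE : {in [set B | [set V jl.1 jl.2 | jl in
      [set jl : 'I_k.+1 * L | V jl.1 jl.2 !=set0]] B /\ B x] &,
      injective (fun B => color B : nat)}.
    move=> B C /set_mem[[[j l] /= _ VB] Bx] /set_mem[[[j' l'] /= _ VC] Cx].
    have /colorP[m [Bm Vm]] : exists j l, B = V j l /\ V j l x.
      by exists j, l; rewrite VB.
    have /colorP[m' [Cm' Vm']] : exists j l, C = V j l /\ V j l x.
      by exists j', l'; rewrite VC.
    move=> /val_inj colBC; rewrite Bm Cm' colBC; rewrite colBC in Vm.
    by rewrite (dV _ _ _ _ Vm Vm').
  rewrite -(card_le_eql (inj_card_eq colorE)).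
  by apply: subset_card_le => _ [B _ <-] /=; exact: ltn_ord.
Qed.

(** As [j] grows the threshold [eta j] decreases and more of the [u i] exceed
    it, but never more than [k].  At the first [j] where at most [j] of them reach
    [eta j], at least [j] already reached [eta (j - 1) > eta j]; so exactly [j] do,
    and none is equal to [eta j]. *)
Lemma threshold_gap (R : realType) (I : finType) (u : I -> R) (eta : nat -> R)
    (k : nat) :
  (forall j, eta j.+1 < eta j) -> 0 < eta k ->
  (#|[set i | (0 < u i)%R]%SET| <= k)%N ->
  exists j : 'I_k.+1, #|[set i | (eta j < u i)%R]%SET| = j :> nat /\
    forall i, u i < eta j \/ eta j < u i.
Proof.
move=> etaS etak uk.
pose ok j := (#|[set i | (eta j <= u i)%R]%SET| <= j)%N.
have okk : ok k.
  apply: leq_trans uk; apply/subset_leq_card/fintype.subsetP => i; rewrite !inE.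
  exact: lt_le_trans.
have ex_ok : exists j, ok j by exists k.
case: (ex_minnP ex_ok) => j okj minj.
have jk : (j < k.+1)%N by rewrite ltnS; exact: minj.
exists (Ordinal jk) => /=.
have sub : [set i | (eta j < u i)%R]%SET \subset [set i | (eta j <= u i)%R]%SET.
  by apply/fintype.subsetP => i; rewrite !inE; exact: ltW.
have jle : (j <= #|[set i | (eta j < u i)%R]%SET|)%N.
  case: j jk okj minj sub => // j jk okj minj sub.
  have : ~~ ok j by apply/negP => /minj; rewrite ltnn.
  rewrite /ok -ltnNge => /leq_trans; apply.
  apply/subset_leq_card/fintype.subsetP => i; rewrite !inE.
  exact: lt_le_trans.
have /eqP eqs : [set i | (eta j < u i)%R]%SET == [set i | (eta j <= u i)%R]%SET.
  by rewrite eqEcard sub (leq_trans okj).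
split; first by apply/eqP; rewrite eqn_leq jle andbT eqs.
move=> i; case: (ltP (u i) (eta j)) => [|le]; first by left.
right; have : i \in [set i | (eta j <= u i)%R]%SET by rewrite inE.
by rewrite -eqs inE.
Qed.

Lemma compact_set_type (T : topologicalType) (A : set T) :
  compact A -> compact [set: A].
Proof.
move=> cA F FF _.
have [|p [Ap clp]] := cA ((set_val : A -> T) @ F) _.
  by apply: (@filterS _ F _ setT) => [x _|]; [exact: set_valP|exact: filterT].
exists (exist _ p (mem_set Ap)); split=> // S B FS [_ [[W oW <-] Wp] WB].
have [_ [[x Sx <-] Wx]] : ([set (set_val x : T) | x in S] `&` W) !=set0.
  apply: clp; last by apply: open_nbhs_nbhs; split.
  by apply: (@filterS _ F _ S) => // x Sx; exists x.
by exists x; split=> //; exact: WB.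
Qed.

(** The union of the faces of dimension at most [k] of the unit cube. *)
Definition skeleton (R : realType) (n k : nat) : set 'rV[R]_n :=
  [set v | (forall i, 0 <= v 0 i <= 1) /\
           (#|[set i | (0 < v 0 i < 1)%R]%SET| <= k)%N].

Lemma set_val_coord_continuous (R : realType) (n : nat) (A : set 'rV[R]_n)
    (i : 'I_n) : continuous (fun x : A => (set_val x : 'rV[R]_n) 0 i).
Proof.
move=> x; apply: (@continuous_comp A 'rV[R]_n R set_val (fun v => v 0 i)).
  exact: initial_continuous.
exact: coord_continuous.
Qed.

Lemma skeleton_compact (R : realType) (n k : nat) : compact (@skeleton R n k).
Proof.
have -> : @skeleton R n k =
    [set v : 'rV[R]_n | forall i, `[0, 1]%classic (v 0 i)]
    `&` [set v : 'rV[R]_n | (#|[set i | (0 < v 0 i < 1)%R]%SET| <= k)%N].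
  by apply/seteqP; split=> v [v01 vk]; split=> // i; have := v01 i;
    rewrite /= in_itv.
apply: compact_closedI.
  apply: (@rV_compact R n (fun=> `[0, 1]%classic)) => i.
  exact: segment_compact.
rewrite -openC openE => v /= /negP; rewrite -ltnNge => kv.
have : \forall w \near v, forall i,
      0 < (v : 'rV[R]_n) 0 i < 1 -> 0 < (w : 'rV[R]_n) 0 i < 1.
  apply: (@filter_forall _ _ (fun i => [set w : 'rV[R]_n |
    0 < (v : 'rV[R]_n) 0 i < 1 -> 0 < w 0 i < 1]) _ (nbhs_filter v)) => i.
  have [vi|_] := boolP (0 < (v : 'rV[R]_n) 0 i < 1); last exact: nearW.
  have : \forall w \near v, `]0, 1[%classic ((w : 'rV[R]_n) 0 i).
    apply: (@coord_continuous R 1 n 0 i v `]0, 1[%classic).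
    by apply: open_nbhs_nbhs; split; [exact: itv_open|rewrite /= in_itv].
  by apply: filterS => w /=; rewrite in_itv.
rewrite /interior; apply: filterS => w vw /=; apply/negP; rewrite -ltnNge.
apply: leq_trans kv _; apply/subset_leq_card/fintype.subsetP => i.
by rewrite !inE; exact: vw.
Qed.

Lemma skeleton_metrizable (R : realType) (n k : nat) :
  metrizable R (set_type (@skeleton R n k)).
Proof.
exists (fun x y => `|(set_val x : 'rV[R]_n) - set_val y|); split.
- split=> [x y|x|x y|x y z]; first by [].
  + by rewrite subrr normr0.
  + by rewrite distrC.
  + exact: ler_distD.
- by move=> x y /eqP; rewrite normr_eq0 subr_eq0 => /eqP /val_inj.
- move=> x A; split.
    move=> /nbhs_ballP[e /= e0 eA]; exists e => // y /= xy; apply: eA.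
    by rewrite /ball /= /initial_ball -ball_normE.
  move=> [e e0 eA]; apply/nbhs_ballP; exists e => // y xy; apply: eA.
  by move: xy; rewrite /ball /= /initial_ball -ball_normE.
Qed.

(** Pieces of the line around the grid of step [1/M]: a neighbourhood of the
    grid point [a/M] when the flag is [false], the middle of the interval between
    [a/M] and [(a + 1)/M] when it is [true].  For fixed [j] the pieces are
    disjoint, and the margin between them shrinks as [j] grows. *)
Definition grid_cell (R : realType) (M j : nat) (ab : 'I_M.+1 * bool) : set R :=
  [set t | let h : R := j.+3%:R^-1 in
     if ab.2 then ab.1%:R + h < M%:R * t < ab.1%:R + 1 - h
     else ab.1%:R - h < M%:R * t < ab.1%:R + h].

Lemma grid_cell_open (R : realType) M j ab : open (@grid_cell R M j ab).
Proof.
have cM : continuous (fun t : R => M%:R * t).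
  by move=> t; exact: mulrl_continuous.
rewrite /grid_cell; case: ab.2 => /=.
  rewrite (_ : mkset _ = (fun t => M%:R * t) @^-1`
    `]ab.1%:R + j.+3%:R^-1, ab.1%:R + 1 - j.+3%:R^-1[%classic); last first.
    by apply/seteqP; split => t /=; rewrite in_itv.
  by move/continuousP : cM; apply; exact: itv_open.
rewrite (_ : mkset _ = (fun t => M%:R * t) @^-1`
  `]ab.1%:R - j.+3%:R^-1, ab.1%:R + j.+3%:R^-1[%classic); last first.
  by apply/seteqP; split => t /=; rewrite in_itv.
by move/continuousP : cM; apply; exact: itv_open.
Qed.

Lemma inv_nat3_bounds (R : realType) (j : nat) :
  0 < (j.+3%:R^-1 : R) <= 3^-1.
Proof. by rewrite invr_gt0 ltr0n lef_pV2 ?posrE ?ltr0n// ler_nat. Qed.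

Lemma grid_cell_inj (R : realType) M j ab ab' (t : R) :
  grid_cell j ab t -> @grid_cell R M j ab' t -> ab = ab'.
Proof.
have /andP[] := inv_nat3_bounds R j.
move: ab ab' => [a b] [a' b']; rewrite /grid_cell /=.
move: (j.+3%:R^-1) (M%:R * t) => h y h0 h1 H1 H2.
have apart (c c' : 'I_M.+1) (e e' : bool) : (c < c')%N ->
    (if e then c%:R + h < y < c%:R + 1 - h else c%:R - h < y < c%:R + h) ->
    (if e' then c'%:R + h < y < c'%:R + 1 - h
     else c'%:R - h < y < c'%:R + h) -> False.
  rewrite -(ler_nat R) -natr1.
  move: (c%:R : R) (c'%:R : R) => x x' xx'.
  by case: e; case: e' => /andP[? ?] /andP[? ?]; lra.
have aa' : a = a'.
  apply/val_inj; case: (ltngtP a a') => // lt; exfalso.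
    exact: apart lt H1 H2.
  exact: apart lt H2 H1.
move: H1 H2; rewrite -{}aa'; move: (a%:R : R) => x H1 H2; congr (_, _).
by move: H1 H2; case: (b); case: (b') => // /andP[? ?] /andP[? ?]; lra.
Qed.

Lemma grid_cell_small (R : realType) M j ab (t u : R) :
  grid_cell j ab t -> @grid_cell R M j ab u -> `|M%:R * t - M%:R * u| < 1.
Proof.
have /andP[] := inv_nat3_bounds R j.
rewrite /grid_cell /=.
move: (j.+3%:R^-1) (M%:R * t) (M%:R * u) (ab.1%:R) => h y z a h0 h1.
by case: ab.2 => /andP[? ?] /andP[? ?];
  rewrite ltr_norml; apply/andP; split; lra.
Qed.

Definition dist_int (R : realType) (y : R) : R :=
  Num.min (y - (Num.truncn y)%:R) ((Num.truncn y).+1%:R - y).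

Lemma grid_cell_far (R : realType) (M j : nat) (t : R) : 0 <= t <= 1 ->
  j.+3%:R^-1 < dist_int (M%:R * t) ->
  exists a : 'I_M.+1, grid_cell j (a, true) t.
Proof.
move=> /andP[t0 t1]; rewrite /dist_int lt_min /grid_cell /=.
move: (j.+3%:R^-1) => h /andP[lo hi].
have y0 : 0 <= M%:R * t by rewrite mulr_ge0.
have /andP[le lt] := truncn_itv y0.
have aM : (Num.truncn (M%:R * t) < M.+1)%N.
  by rewrite ltnS -(ler_nat R) (le_trans le)// -[leRHS]mulr1 ler_wpM2l.
exists (Ordinal aM); apply/andP => /=.
move: (M%:R * t) lo hi {aM le lt y0} => y; rewrite -natr1.
by move: (Num.truncn y) => m lo hi; split; lra.
Qed.

Lemma grid_cell_near (R : realType) (M j : nat) (t : R) : 0 <= t <= 1 ->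
  dist_int (M%:R * t) < j.+3%:R^-1 ->
  exists a : 'I_M.+1, grid_cell j (a, false) t.
Proof.
move=> /andP[t0 t1].
have /andP[] := inv_nat3_bounds R j.
have y0 : 0 <= M%:R * t by rewrite mulr_ge0.
have /andP[le lt] := truncn_itv y0.
have yM : M%:R * t <= M%:R by rewrite -[leRHS]mulr1 ler_wpM2l.
have aM : (Num.truncn (M%:R * t) < M.+1)%N.
  by rewrite ltnS -(ler_nat R) (le_trans le).
rewrite /dist_int gt_min /grid_cell /=.
move: (j.+3%:R^-1) => h h0 h1 /orP[near|near].
  exists (Ordinal aM) => /=; move: (M%:R * t) near le {lt aM yM y0} => y.
  by move: (Num.truncn y) => m near le; apply/andP; split; lra.
move: aM; rewrite ltnS leq_eqVlt => /predU1P[eqM|aM].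
  move: near yM {lt le y0}; rewrite eqM -natr1.
  by move: (M%:R * t) => y ? ?; lra.
exists (Ordinal (aM : _.+1 < M.+1)%N) => /=.
move: (M%:R * t) near lt {aM yM le y0} => y.
by rewrite -natr1; move: (Num.truncn y) => m near lt; apply/andP; split; lra.
Qed.

Lemma dist_int_gt0 (R : realType) (M : nat) (t : R) : 0 <= t <= 1 ->
  0 < dist_int (M%:R * t) -> 0 < t < 1.
Proof.
move=> /andP[t0 t1]; rewrite /dist_int lt_min => /andP[lo hi].
rewrite !lt_neqAle t0 t1 !andbT; apply/andP; split; apply/eqP => teq.
  by rewrite -teq mulr0 truncn0 subr0 ltxx in lo.
by rewrite teq mulr1 natrK subrr ltxx in lo.
Qed.

(** Refine the skeleton by a fine grid: its points still have at most [k]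
    coordinates off the grid.  The members of colour [j] are thickenings of the
    grid cells of dimension [j], disjoint because for a fixed [j] each coordinate
    belongs to at most one [grid_cell].  They cover because [threshold_gap],
    applied to the distances of the coordinates to the grid, finds for each point
    a [j] for which the point has exactly [j] coordinates off the grid at scale
    [1/(j + 3)]. *)
Lemma skeleton_dim (R : realType) (n k : nat) :
  covering_dim_le (set_type (@skeleton R n k)) k.
Proof.
apply: (@covering_dim_le_colored R).
  exact/compact_set_type/skeleton_compact.
move=> e e0.
pose M := (Num.truncn e^-1).+1.
have eM : 1 < M%:R * e by rewrite -ltr_pdivrMr// mul1r; exact: truncnS_gt.
pose K := set_type (@skeleton R n k).
pose co (x : K) i := (set_val x : 'rV[R]_n) 0 i.
have coP (x : K) : skeleton k (set_val x : 'rV[R]_n).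
  exact: (set_mem (valP x)).
exists {ffun 'I_n -> 'I_M.+1 * bool}.
exists (fun (j : 'I_k.+1) (l : {ffun 'I_n -> 'I_M.+1 * bool}) =>
  [set x : K | #|[set i | (l i).2]%SET| = j :> nat /\
   forall i, grid_cell j (l i) (co x i)]).
split.
- move=> j l; rewrite openE => x [lj xl].
  have : \forall y \near x, forall i, grid_cell j (l i) (co y i).
    apply: (@filter_forall _ _ (fun i => [set y : K |
      grid_cell j (l i) (co y i)]) _ (nbhs_filter x)) => i.
    apply: (@set_val_coord_continuous R n _ i x (grid_cell j (l i))).
    by apply: open_nbhs_nbhs; split; [exact: grid_cell_open|exact: xl].
  by rewrite /interior; apply: filterS => y.
- move=> x; have [x01 xk] := coP x.
  have [|||j [cj dj]] := @threshold_gap R 'I_n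
      (fun i => dist_int (M%:R * co x i)) (fun j => j.+3%:R^-1) k.
  + by move=> j; rewrite ltf_pV2 ?posrE ?ltr0n// ltr_nat.
  + by rewrite invr_gt0 ltr0n.
  + apply: leq_trans xk; apply/subset_leq_card/fintype.subsetP => i.
    by rewrite !inE; exact: (dist_int_gt0 (x01 i)).
  have /fin_all_exists[a aP] : forall i, exists a : 'I_M.+1,
      grid_cell j (a, j.+3%:R^-1 < dist_int (M%:R * co x i)) (co x i).
    move=> i; case: (dj i) => H; last first.
      by rewrite H; exact: grid_cell_far (x01 i) H.
    by rewrite ltNge (ltW H); exact: grid_cell_near (x01 i) H.
  exists j, [ffun i => (a i, j.+3%:R^-1 < dist_int (M%:R * co x i))]; split.
    by apply: etrans cj; apply: eq_card => i; rewrite !inE ffunE.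
  by move=> i; rewrite ffunE.
- move=> j l l' x [_ xl] [_ xl']; apply/ffunP => i.
  exact: grid_cell_inj (xl i) (xl' i).
- move=> j l x y [_ xl] [_ yl]; rewrite /ball /= /initial_ball.
  split => // i' i; rewrite ord1 /ball /=.
  have := grid_cell_small (xl i) (yl i).
  have M0 : 0 < (M%:R : R) by rewrite ltr0n.
  rewrite -mulrBr normrM ger0_norm// => H.
  by rewrite -(ltr_pM2l M0) (lt_trans H).
Qed.

(** * Maps to a skeleton *)

Lemma row_continuous (R : realType) (T : topologicalType) (n : nat)
    (f : T -> 'rV[R]_n) :
  (forall i, continuous (fun x => f x 0 i)) -> continuous f.
Proof.
move=> cf x A /nbhs_ballP[e /= e0 eA].
have : nbhs x [set y | forall i, ball (f x 0 i) e (f y 0 i)].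
  apply: (@filter_forall _ _ (fun i => [set y | ball (f x 0 i) e (f y 0 i)])
    _ (nbhs_filter x)) => i.
  exact: (cf i x (ball (f x 0 i) e) (nbhsx_ballx _ _ e0)).
apply: (@filterS _ _ (nbhs_filter x)) => y xy; apply: eA; split=> // i' i.
by rewrite ord1.
Qed.

Lemma wdim_le_skeleton (R : realType) (Y : topologicalType) (dist : Y -> Y -> R)
    (eps : R) (n k : nat) (f : Y -> 'rV[R]_n) :
  continuous f -> (forall y, skeleton k (f y)) ->
  (forall x y, f x = f y -> dist x y < eps) ->
  (wdim dist eps <= k%:R%:E)%E.
Proof.
move=> cf fk finj; pose K := set_type (@skeleton R n k).
apply: (@le_trans _ _ (covering_dim R K)); last first.
  rewrite /covering_dim; case: ifP => _; first by rewrite leNye.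
  by apply: ereal_inf_lbound; exists k => //; exact: skeleton_dim.
apply: ereal_inf_lbound; exists K; split=> //.
- exact/compact_set_type/skeleton_compact.
- exact: skeleton_metrizable.
exists (fun y => exist _ (f y) (mem_set (fk y)) : K).
- move=> y A [_ [[W oW <-] Wy] WA].
  have : nbhs y (f @^-1` W) by apply: cf; apply: open_nbhs_nbhs; split.
  by apply: (@filterS _ _ (nbhs_filter y)) => z Wz; exact: WA.
- by move=> x y /(congr1 val) /= /finj.
Qed.

(** The space itself is an admissible target, of dimension [-oo]. *)
Lemma wdim_empty (R : realType) (Y : topologicalType) (dist : Y -> Y -> R)
    (eps : R) : (Y -> False) -> wdim dist eps = -oo%E.
Proof.
move=> Y0; apply/eqP; rewrite -leeNy_eq; apply: ereal_inf_lbound; exists Y.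
split.
- move=> F FF FT; exfalso.
  by have [y _] := @filter_ex _ F FF _ FT.
- exists (fun _ _ => 0); split; [split=> x|by move=> x|by move=> x];
    by case: (Y0 x).
- rewrite /covering_dim; case: ifPn => // /asboolPn; case.
  by apply/seteqP; split=> // y; case: (Y0 y).
- by exists id => // x; case: (Y0 x).
Qed.

(** First moment method with exponential weights.  Give the choice [t] of cells
    and the centre [c] the weight [z ^ (number of coordinates where t is close to
    c)], with [z = Q / B].  For a fixed [c] the sum over [t] is a product over the
    coordinates of factors at most [B z + Q = 2 Q].  If every [t] had [m] close
    coordinates for some [c], the total weight would be at least [Q ^ |I| z ^ m],
    against the hypothesis. *)
Lemma exists_sparse_cells (R : realType) (I J : finType) (Q B m : nat)
    (close : J -> I -> pred 'I_Q) :
  (0 < B)%N -> (B <= Q)%N -> (forall c i, (#|close c i| <= B)%N) ->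
  #|J|%:R * 2 ^+ #|I| < (Q%:R / B%:R) ^+ m :> R ->
  exists t : {ffun I -> 'I_Q},
    forall c, (#|[set i | close c i (t i)]%SET| < m)%N.
Proof.
move=> B0 BQ closeB lt; apply: contrapT => /forallNP nt.
pose z : R := Q%:R / B%:R.
have B0' : 0 < (B%:R : R) by rewrite ltr0n.
have Q0 : (0 < Q)%N by exact: leq_trans BQ.
have z1 : 1 <= z by rewrite ler_pdivlMr// mul1r ler_nat.
have z0 : 0 <= z by exact: le_trans z1.
pose wt c (t : {ffun I -> 'I_Q}) := \prod_i (if close c i (t i) then z else 1).
have wtE c t : wt c t = z ^+ #|[set i | close c i (t i)]%SET|.
  rewrite /wt -big_mkcond /= prodr_const; congr (_ ^+ _).
  by apply: eq_card => i; rewrite inE.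
have up c : \sum_t wt c t <= (2 * Q%:R) ^+ #|I|.
  (* the sum over all choices factors over the coordinates *)
  rewrite /wt -(bigA_distr_bigA (fun i j => if close c i j then z else 1)) /=.
  rewrite -prodr_const; apply: ler_prod => i _; apply/andP; split.
    by apply: sumr_ge0 => j _; case: ifP.
  rewrite mulr_natl mulr2n.
  apply: (@le_trans _ _ (\sum_(j < Q) ((if close c i j then z else 0) + 1))).
    by apply: ler_sum => j _; case: ifP; rewrite ?add0r ?lerDl.
  rewrite big_split /= sumr_const card_ord lerD2r -big_mkcond /= sumr_const.
  apply: (@le_trans _ _ (z *+ B)).
    by rewrite ler_wpMn2l// (leq_trans _ (closeB c i))// subset_leq_card//.
  by rewrite -[z *+ B]mulr_natr divfK ?gt_eqF.
have lo t : z ^+ m <= \sum_c wt c t.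
  have [c] : exists c, ~ (#|[set i | close c i (t i)]%SET| < m)%N.
    by apply/existsNP => H; apply: (nt t).
  move/negP; rewrite -leqNgt => mc.
  rewrite (bigD1 c) //= wtE -[leLHS]addr0 lerD ?ler_weXn2l//.
  by apply: sumr_ge0 => c' _; rewrite wtE exprn_ge0.
have : Q%:R ^+ #|I| * z ^+ m <= #|J|%:R * (2 * Q%:R) ^+ #|I|.
  apply: (@le_trans _ _ (\sum_t \sum_c wt c t)).
    apply: (@le_trans _ _ (\sum_(t : {ffun I -> 'I_Q}) z ^+ m));
      last exact: ler_sum.
    by rewrite sumr_const card_ffun card_ord -[_ *+ (_ ^ _)%N]mulr_natl natrX.
  rewrite exchange_big /= mulr_natl -sumr_const; exact: ler_sum.
apply/negP; rewrite -ltNge exprMn mulrA mulrC ltr_pM2l//.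
by rewrite exprn_gt0// ltr0n.
Qed.

Lemma card_close_cells (R : realType) (Q C : nat) (y : R) :
  (#|[set t : 'I_Q | (`|y - t%:R| < C%:R)%R]%SET| <= C.*2)%N.
Proof.
set S := [set t : 'I_Q | _]%SET.
have [->|[s0 s0S]] := set_0Vmem S; first by rewrite cards0.
case: (arg_minnP (fun t : 'I_Q => t : nat) s0S) => s sS smin.
have {}sS : s \in S by exact: sS.
rewrite cardE -(size_map val) -(size_iota s C.*2).
apply: uniq_leq_size.
  by rewrite map_inj_uniq ?enum_uniq//; exact: val_inj.
move=> _ /mapP[t + ->]; rewrite mem_enum mem_iota => tS; rewrite smin//=.
move: tS sS; rewrite !inE !ltr_norml => /andP[t1 t2] /andP[s1 s2].
rewrite -(ltr_nat R) natrD -addnn natrD.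
by move: (C%:R : R) (t%:R : R) (s%:R : R) t1 t2 s1 s2 => c u v; lra.
Qed.

(** Collapse of [[0, 1]] onto the cell [[t/Q, (t + 1)/Q]], rescaled to
    [[0, 1]]. *)
Definition cell_coord (R : realType) (Q : nat) (t : 'I_Q) (y : R) : R :=
  Num.min 1 (Num.max 0 (Q%:R * y - t%:R)).

Lemma cell_coord_continuous (R : realType) Q (t : 'I_Q) :
  continuous (@cell_coord R Q t).
Proof.
move=> y.
apply: (@continuous_min R R (fun=> 1)
  (fun z => Num.max 0 (Q%:R * z - t%:R)) y); first exact: cvg_cst.
apply: (@continuous_max R R (fun=> 0) (fun z => Q%:R * z - t%:R) y).
  exact: cvg_cst.
by apply: cvgB; [exact: mulrl_continuous|exact: cvg_cst].
Qed.

Lemma cell_coord_itv (R : realType) Q (t : 'I_Q) (y : R) :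
  0 <= cell_coord t y <= 1.
Proof. by rewrite /cell_coord le_min ge_min lexx ler01 le_max lexx. Qed.

Lemma cell_coord0 (R : realType) Q (t : 'I_Q) : cell_coord t 0 = 0 :> R.
Proof. by rewrite /cell_coord mulr0 sub0r max_l ?oppr_le0// min_r. Qed.

Lemma cell_coord1 (R : realType) Q (t : 'I_Q) : cell_coord t 1 = 1 :> R.
Proof.
rewrite /cell_coord mulr1 min_l// le_max; apply/orP; right.
by rewrite lerBrDr nat1r ler_nat.
Qed.

Lemma cell_coord_frac (R : realType) Q (t : 'I_Q) (y : R) :
  0 < cell_coord t y < 1 -> `|(Q%:R * y - 2^-1) - t%:R| < 2^-1.
Proof.
rewrite /cell_coord lt_min gt_min lt_max gt_max ltr01 ltxx /= => /andP[H1 H2].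
by rewrite ltr_norml; apply/andP; split; lra.
Qed.

(** If [y i] is inside the cell [t i], then either [c i] is within [C / Q] of the
    centre of that cell, or [y i] and [c i] differ by at least [C / (2 Q)]; by
    Markov's inequality the latter happens at most [2 Q s / C] times. *)
Lemma card_frac_coords (R : realType) (I : finType) (Q C m : nat)
    (y c : I -> R) (s : R) (t : I -> 'I_Q) :
  (0 < C)%N -> \sum_i `|y i - c i| <= s ->
  (#|[set i | (`|(Q%:R * c i - 2^-1) - (t i)%:R| < C%:R)%R]%SET| < m)%N ->
  #|[set i | (0 < cell_coord (t i) (y i) < 1)%R]%SET|%:R
    <= m%:R + 2 * Q%:R * s / C%:R :> R.
Proof.
move=> C0 ys cm.
have C1 : 1 <= (C%:R : R) by rewrite ler1n.
have C0' : 0 < (C%:R : R) by rewrite ltr0n.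
set A := [set i | _]%SET in cm.
pose B := [set i | (C%:R <= 2 * Q%:R * `|y i - c i|)%R]%SET.
have sub : [set i | (0 < cell_coord (t i) (y i) < 1)%R]%SET \subset A :|: B.
  apply/fintype.subsetP => i; rewrite !inE => /cell_coord_frac H.
  rewrite orbC -implyNb -ltNge; apply/implyP => H'.
  have Q0 : 0 <= (Q%:R : R) by [].
  have -> : Q%:R * c i - 2^-1 - (t i)%:R =
    (Q%:R * y i - 2^-1 - (t i)%:R) - Q%:R * (y i - c i) by ring.
  apply: le_lt_trans (ler_normB _ _) _.
  rewrite normrM (ger0_norm Q0).
  move: (`|_ - (t i)%:R|) (`|y i - c i|) H H' C1 => u v H H' C1.
  by rewrite -mulrA in H'; move: (Q%:R * v) H' => w H'; lra.
apply: (@le_trans _ _ (#|A|%:R + #|B|%:R)).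
  by rewrite -natrD ler_nat (leq_trans (subset_leq_card sub)) ?leq_card_setU.
apply: lerD; first by rewrite ler_nat ltnW.
rewrite ler_pdivlMr//.
apply: (@le_trans _ _ (2 * Q%:R * \sum_i `|y i - c i|)); last first.
  by rewrite ler_wpM2l// mulr_ge0.
apply: (@le_trans _ _ (\sum_(i in B) C%:R)).
  by rewrite sumr_const mulr_natl.
rewrite mulr_sumr [leLHS]big_mkcond /=; apply: ler_sum => i _.
by rewrite inE; case: ifP => // _; rewrite !mulr_ge0.
Qed.

(** The map to the skeleton is [phi |-> cell_coord (t (a, k)) (w a (phi k))] for
    the cells [t] given by [exists_sparse_cells].  Since [cell_coord] fixes [0]
    and [1], two points with the same image satisfy: wherever [w a (x k) = 1],
    also [w a (y k) > 0]; hence they are [eps]-close at every [k]. *)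
Lemma wdim_le_cover (R : realType) (X : topologicalType) (dn : nat)
    (Y : set {ptws 'I_dn -> X}) (l : nat) (w : 'I_l -> X -> R)
    (rho : X -> X -> R) (eps : R) (N : nat)
    (c : 'I_N -> 'I_l * 'I_dn -> R) (s : R) (Q C m : nat) :
  0 < eps ->
  (forall a, continuous (w a)) -> (forall a x, 0 <= w a x) ->
  (forall x, exists a, w a x = 1) ->
  (forall a x y, w a x = 1 -> 0 < w a y -> rho x y < eps) ->
  (forall phi, Y phi -> exists j,
     \sum_(i : 'I_l * 'I_dn) `|w i.1 (phi i.2) - c j i| <= s) ->
  (0 < C)%N -> (C.*2 <= Q)%N ->
  N%:R * 2 ^+ (l * dn) < (Q%:R / C.*2%:R) ^+ m :> R ->
  (wdim (fun x y : set_type Y => power_dist +oo%E rho (set_val x) (set_val y))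
     eps <= (Num.truncn (m%:R + 2 * Q%:R * s / C%:R))%:R%:E)%E.
Proof.
move=> eps0 cw w0 w1 wsep cov C0 CQ lt.
pose I := ('I_l * 'I_dn)%type.
have [||||t tP] := @exists_sparse_cells R I 'I_N Q C.*2 m
  (fun j i t => `|(Q%:R * c j i - 2^-1) - t%:R| < C%:R).
- by rewrite double_gt0.
- exact: CQ.
- move=> j i; apply: leq_trans (card_close_cells _ _ (Q%:R * c j i - 2^-1)).
  by apply: subset_leq_card; apply/fintype.subsetP => u; rewrite !inE.
- by rewrite card_ord card_prod !card_ord.
pose f (phi : set_type Y) : 'rV[R]_#|{: I}| := \row_i
  cell_coord (t (enum_val i))
    (w (enum_val i).1 ((set_val phi : {ptws 'I_dn -> X}) (enum_val i).2)).
apply: (@wdim_le_skeleton _ _ _ _ #|{: I}| _ f).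
- apply: row_continuous => i.
  set i1 := (enum_val i).1; set i2 := (enum_val i).2.
  have -> : (fun phi => f phi 0 i) = cell_coord (t (enum_val i)) \o
      (w i1 \o ((fun phi : {ptws 'I_dn -> X} => phi i2) \o
        (set_val : set_type Y -> _))).
    by apply/funext => phi; rewrite /f mxE.
  move=> phi; apply: continuous_comp; last exact: cell_coord_continuous.
  apply: continuous_comp; last exact: cw.
  apply: continuous_comp; first exact: initial_continuous.
  exact: proj_continuous.
- move=> phi; split=> [i|]; first by rewrite mxE cell_coord_itv.
  have [j jP] := cov _ (set_mem (valP phi)).
  have H := card_frac_coords C0 jP (tP j).
  rewrite truncn_ge_nat ?(le_trans (ler0n _ _) H)//.
  apply: le_trans H; rewrite ler_nat.
  rewrite -(card_imset _ enum_val_inj); apply: subset_leq_card.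
  by apply/fintype.subsetP => _ /imsetP[i + ->]; rewrite !inE mxE.
- move=> x y fxy; rewrite /power_dist; apply/bigmax_ltP; split=> // k _.
  have [a wa] := w1 ((set_val x : {ptws 'I_dn -> X}) k); apply: (wsep a _ _ wa).
  have := congr1 (fun v : 'rV[R]_ _ => v 0 (enum_rank ((a, k) : I))) fxy.
  rewrite !mxE enum_rankK /= wa cell_coord1 => H.
  rewrite lt_neqAle w0 andbT; apply/eqP => H0.
  by move: H; rewrite -H0 cell_coord0 => /eqP; rewrite oner_eq0.
Qed.

(** * Compactness and dynamically generating pseudometrics *)

Lemma continuous_pseudometric_bounded (R : realType) (X : topologicalType)
    (rho : X -> X -> R) :
  compact [set: X] -> continuous_pseudometric rho ->
  exists2 M : R, 0 < M & forall x y, rho x y <= M.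
Proof.
move=> cX [_ crho].
have cXX : compact [set: X * X] by rewrite -setXTT; exact: compact_setX.
have /continuous_subspaceT/continuous_compact/(_ cXX)/compact_bounded[M [_ HM]]
  := crho.
exists (`|M| + 1); first by rewrite ltr_pwDr.
move=> x y; apply: le_trans (ler_norm _) _.
apply: (HM (`|M| + 1)); first by rewrite (le_lt_trans (ler_norm _))// ltrDl.
by exists (x, y).
Qed.

Lemma compatible_metric_continuous (R : realType) (X : topologicalType)
    (rho : X -> X -> R) :
  compatible_metric rho -> continuous_pseudometric rho.
Proof.
move=> [prho _ nrho]; split=> //.
have [rho0 _ rhoC rhoD] := prho.
move=> [x y] A /nbhs_ballP[e /= e0 eA].
exists ([set x' | rho x x' < e / 2], [set y' | rho y y' < e / 2]) => /=.
  by split; apply/nrho; exists (e / 2) => //; rewrite divr_gt0.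
move=> [x' y'] /= [xx' yy']; apply: eA; rewrite /ball /= ltr_norml.
have := rhoD x x' y; have := rhoD x' x y'.
have := rhoD x y y'; have := rhoD x' y' y.
rewrite (rhoC x' x) (rhoC y' y) => ? ? ? ?.
by apply/andP; split; lra.
Qed.

(** Near a pair with [tau x y < e] nothing is required; near any other pair some
    [rho (g x) (g y)] is bounded below.  Compactness of [X * X], as near-covering
    along the filter of growing finite sets [E] and shrinking thresholds, makes
    this uniform. *)
Lemma generating_controls (R : realType) (G : groupType) (X : topologicalType)
    (act : G -> X -> X) (rho tau : X -> X -> R) (e : R) :
  compact [set: X] -> (forall g, continuous (act g)) ->
  dyn_generating act rho -> continuous_pseudometric tau -> 0 < e ->
  exists (E : seq G) (th : R), 0 < th /\ forall x y,
    (forall g, g \in E -> rho (act g x) (act g y) < th) -> tau x y < e.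
Proof.
move=> cX cact [[prho crho] grho] [[_ tau0 _ _] ctau] e0.
have /compact_near_coveringP cXX : compact [set: X * X].
  by rewrite -setXTT; exact: compact_setX.
pose tail (Et : seq G * R) := [set Et' : seq G * R |
  {subset Et.1 <= Et'.1} /\ 0 < Et'.2 <= Et.2].
pose F := filter_from [set Et : seq G * R | 0 < Et.2] tail.
have FF : Filter F.
  apply: filter_from_filter; first by exists ([::], 1) => /=.
  move=> [E1 t1] [E2 t2] /= t10 t20; exists (E1 ++ E2, Num.min t1 t2) => /=.
    by rewrite lt_min t10.
  move=> [E t] [/= EE /andP[t0]]; rewrite le_min => /andP[tt1 tt2].
  by split; split=> /=; rewrite ?t0 // => g gE; apply: EE;
    rewrite mem_cat gE ?orbT.
pose P (Et : seq G * R) (xy : X * X) :=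
  (forall g, g \in Et.1 -> rho (act g xy.1) (act g xy.2) < Et.2) ->
  tau xy.1 xy.2 < e.
have [|[E t] /= t0 H] := cXX _ F P FF.
  move=> [x y] _.
  have [lt|ge] := ltP (tau x y) e.
    have N : \forall z \near (x, y), tau z.1 z.2 < e.
      apply: (ctau (x, y) [set r | r < e]).
      by apply: open_nbhs_nbhs; split=> //; exact: open_lt.
    exists ([set z | tau z.1 z.2 < e], setT) => /=.
      by split; [exact: N|exact: filterT].
    by move=> [z Et] /= [lt' _] _; exact: lt'.
  have [g rg] : exists g, 0 < rho (act g x) (act g y).
    by apply: grho => xy; move: ge; rewrite xy tau0 leNgt e0.
  pose r := rho (act g x) (act g y).
  exists ([set z | r / 2 < rho (act g z.1) (act g z.2)],
    tail ([:: g], r / 2)) => /=.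
    split; last by exists ([:: g], r / 2) => //=; rewrite divr_gt0.
    have [[A B] /= [nA nB] AB] : \forall u \near (act g x, act g y),
        r / 2 < rho u.1 u.2.
      apply: (crho (act g x, act g y) [set s | r / 2 < s]).
      apply: open_nbhs_nbhs; split; first exact: open_gt.
      by rewrite /= /r ltr_pdivrMr// ltr_pMr// ltr1n.
    exists (act g @^-1` A, act g @^-1` B) => /=.
      by split; exact: cact.
    by move=> [z1 z2] /= [Az Bz]; exact: (AB (_, _)).
  move=> [[z1 z2] [E t]] /= [rz [gE /andP[_ tr]]] /(_ g).
  rewrite gE ?mem_head// => /(_ isT) /lt_le_trans /(_ tr) /(lt_trans rz).
  by rewrite ltxx.
exists E, t; split=> // x y; apply: (H (E, t) _ (x, y)) => //.
by split=> //=; rewrite t0 lexx.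
Qed.

Definition bump (R : realType) (u : R) : R := Num.max 0 (Num.min 1 (2 - u)).

Lemma bump_ge0 (R : realType) (u : R) : 0 <= bump u.
Proof. by rewrite /bump le_max lexx. Qed.

Lemma bump_eq1 (R : realType) (u : R) : (bump u = 1) <-> (u <= 1).
Proof.
split=> [u1|u1]; last by rewrite /bump min_l ?max_r//; lra.
have : 1 <= bump u by rewrite u1.
by rewrite /bump le_max le_min lexx /= => /orP[]; lra.
Qed.

Lemma bump_gt0 (R : realType) (u : R) : 0 < bump u -> u < 2.
Proof. by rewrite /bump lt_max ltxx /= lt_min => /andP[_]; lra. Qed.

Lemma bump_lip (R : realType) (u v : R) : `|bump u - bump v| <= `|u - v|.
Proof.
have half (a b : R) : bump a - bump b <= `|a - b|.
  have : b - a <= `|a - b| by rewrite distrC ler_norm.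
  have : 0 <= `|a - b| by [].
  move: (`|a - b|) => d d0 ab; rewrite lerBlDr /bump ge_max; apply/andP; split.
    by apply: addr_ge0; rewrite // le_max lexx.
  rewrite ge_min; apply/orP.
  case: (leP 1 (2 - b)) => ?; first by left; rewrite max_r//; lra.
  by right; case: (leP 0 (2 - b)) => ?; lra.
by rewrite ler_norml half andbT lerNl opprB distrC half.
Qed.

Lemma bump_continuous (R : realType) : continuous (@bump R).
Proof.
move=> u A /nbhs_ballP[e /= e0 eA]; apply/nbhs_ballP; exists e => // v uv.
by apply: eA; apply: le_lt_trans uv; exact: bump_lip.
Qed.

Definition sum_dist (R : realType) (G : groupType) (X : Type)
    (act : G -> X -> X) (rho : X -> X -> R) (E : seq G) (x y : X) : R :=
  \sum_(g <- E) rho (act g x) (act g y).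

Section SumDist.
Context (R : realType) (G : groupType) (X : topologicalType)
  (act : G -> X -> X) (rho : X -> X -> R) (E : seq G) (rhoP : pseudometric rho).

Lemma sum_dist_pseudometric : pseudometric (sum_dist act rho E).
Proof.
have [rho0 rhoxx rhoC rhoD] := rhoP; rewrite /sum_dist; split.
- by move=> x y; apply: sumr_ge0.
- by move=> x; rewrite big1.
- by move=> x y; apply: eq_bigr.
- by move=> x y z; rewrite -big_split /=; apply: ler_sum.
Qed.

Lemma sum_dist_ge g x y :
  g \in E -> rho (act g x) (act g y) <= sum_dist act rho E x y.
Proof.
have [rho0 _ _ _] := rhoP; rewrite /sum_dist.
elim: E => // h E' IH; rewrite inE big_cons => /predU1P[->|gE].
  by rewrite lerDl sumr_ge0.
by rewrite (le_trans (IH gE))// lerDr.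
Qed.

Lemma sum_dist_continuous : (forall g, continuous (act g)) ->
  continuous (fun xy : X * X => rho xy.1 xy.2) ->
  forall z, continuous (sum_dist act rho E z).
Proof.
move=> cact crho z; elim: E => [|g E' IH] x.
  rewrite (_ : sum_dist act rho [::] z = fun=> 0); first exact: cvg_cst.
  by apply/funext => y; rewrite /sum_dist big_nil.
rewrite (_ : sum_dist act rho (g :: E') z =
    fun y => rho (act g z) (act g y) + sum_dist act rho E' z y); last first.
  by apply/funext => y; rewrite /sum_dist big_cons.
apply: cvgD; last exact: IH.
move=> A nA.
have [[B C] /= [nB nC] BC] := crho (act g z, act g x) A nA.
apply: (@filterS _ (nbhs x) _ _ _ _ (cact g x C nC)) => y Cy.
by apply: (BC (_, _)); split=> //; exact: nbhs_singleton.
Qed.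

End SumDist.

(** Bumps around the centres of finitely many balls of radius [th / 4] covering
    [X] for the pseudometric [sum_dist], where [sum_dist < th] forces
    [tau < e]: two points in the support of one bump, one of them on its plateau,
    are at distance less than [th / 4 + th / 2]. *)
Lemma separating_bumps (R : realType) (G : groupType) (X : topologicalType)
    (act : G -> X -> X) (rho tau : X -> X -> R) (e : R) :
  compact [set: X] -> (forall g, continuous (act g)) ->
  dyn_generating act rho -> continuous_pseudometric tau -> 0 < e ->
  exists (E : seq G) (L : R) (l : nat) (w : 'I_l -> X -> R),
  [/\ 0 < L, forall a, continuous (w a) /\ forall x, 0 <= w a x,
      forall x, exists a, w a x = 1,
      forall a x y, w a x = 1 -> 0 < w a y -> tau x y < e
    & forall a x y, `|w a x - w a y| <= L * sum_dist act rho E x y].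
Proof.
move=> cX cact grho ctau e0.
have [E [th [th0 Eth]]] := generating_controls cX cact grho ctau e0.
have [[prho crho] _] := grho.
have [D0 Dxx DC DD] := sum_dist_pseudometric act E prho.
pose D := sum_dist act rho E.
have cD z : continuous (D z) by exact: sum_dist_continuous.
(* compactness, as near-covering along the filter of growing finite sets *)
have [Z covZ] : exists Z : seq X, forall x, exists2 z, z \in Z & D z x < th / 4.
  pose tail (Z : seq X) := [set Z' : seq X | {subset Z <= Z'}].
  have FF : Filter (filter_from setT tail).
    apply: filter_from_filter; first by exists [::].
    move=> Z Z' _ _; exists (Z ++ Z') => // Z'' /= ZZ.
    by split=> z zZ; apply: ZZ; rewrite mem_cat zZ ?orbT.
  have /compact_near_coveringP cX' := cX.
  have [|Z _ HZ] := cX' _ _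
      (fun (Z : seq X) x => exists2 z, z \in Z & D z x < th / 4) FF.
    move=> x _; exists ([set y | D x y < th / 4], tail [:: x]) => /=.
      split; last by exists [:: x].
      apply: (cD x x [set r | r < th / 4]).
      apply: open_nbhs_nbhs; split; first exact: open_lt.
      by rewrite /= /D Dxx divr_gt0.
    by move=> [y Z] /= [xy xZ]; exists x => //; apply: xZ; rewrite mem_head.
  by exists Z => x; exact: HZ.
pose l := size Z; pose z (a : 'I_l) := tnth (in_tuple Z) a.
exists E, (4 / th), l, (fun a x => bump (4 / th * D (z a) x)); split.
- by rewrite divr_gt0.
- move=> a; split=> [x|x]; last exact: bump_ge0.
  apply: (@continuous_comp _ _ _ (fun x => 4 / th * D (z a) x) (@bump R));
    last exact: bump_continuous.
  by apply: (@continuous_comp _ _ _ (D (z a)) (fun u => 4 / th * u));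
    [exact: cD|exact: mulrl_continuous].
- move=> x; have [y yZ yx] := covZ x.
  have lt : (index y Z < l)%N by rewrite index_mem.
  exists (Ordinal lt); apply/bump_eq1.
  rewrite /z (tnth_nth y) /= nth_index// mulrAC ler_pdivrMr// mul1r.
  by rewrite mulrC -ler_pdivlMr// ltW.
- move=> a x y /bump_eq1 ax /bump_gt0 ay; apply: Eth => g gE.
  apply: le_lt_trans (sum_dist_ge act prho x y gE) _.
  apply: le_lt_trans (DD x (z a) y) _; rewrite DC -/D.
  move: ax ay; rewrite !(mulrAC 4 th^-1) ler_pdivrMr// ltr_pdivrMr//.
  by move: (D _ x) (D _ y) => u v; lra.
- move=> a x y; apply: le_trans (bump_lip _ _) _.
  have L0 : 0 <= 4 / th by rewrite divr_ge0// ltW.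
  rewrite -mulrBr normrM ger0_norm// ler_wpM2l//.
  have := DD (z a) x y; have := DD (z a) y x; rewrite (DC y x) -/D => ? ?.
  by rewrite ler_norml; apply/andP; split; lra.
Qed.

(** * Almost equivariance of the elements of Map *)

(** Cauchy-Schwarz, in the form [r <= (r^2 / c + c) / 2]. *)
Lemma power_dist2_lt_sum (R : realType) (X : Type) (rho : X -> X -> R) (n : nat)
    (x y : 'I_n -> X) (c : R) :
  (forall a b, 0 <= rho a b) -> (0 < n)%N -> 0 < c ->
  power_dist 2%:E rho x y < c -> \sum_k rho (x k) (y k) <= n%:R * c.
Proof.
move=> rho0 n0 c0; rewrite /power_dist => lt.
have n0' : 0 < (n%:R : R) by rewrite ltr0n.
pose A := n%:R^-1 * \sum_k rho (x k) (y k) `^ 2.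
have A0 : 0 <= A by rewrite mulr_ge0// sumr_ge0// => k _; exact: powR_ge0.
have Ac : A <= c ^+ 2.
  have -> : A = (A `^ 2^-1) ^+ 2.
    by rewrite -powR_mulrn ?powR_ge0// -powRrM mulVf ?powRr1.
  by rewrite ler_pXn2r ?nnegrE ?powR_ge0 ?(ltW c0)// ltW.
have SA : \sum_k rho (x k) (y k) ^+ 2 <= n%:R * c ^+ 2.
  rewrite -ler_pdivrMl//; apply: le_trans Ac; rewrite /A ler_wpM2l ?invr_ge0//.
  by apply: ler_sum => k _; rewrite powR_mulrn.
have le k : rho (x k) (y k) <= (rho (x k) (y k) ^+ 2 / c + c) / 2.
  rewrite ler_pdivlMr// -(ler_pM2r c0) mulrDl divfK ?gt_eqF//.
  set u := rho _ _.
  have -> : u * 2 * c = u ^+ 2 + c * c - (u - c) ^+ 2 by ring.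
  by rewrite lerBlDr lerDl sqr_ge0.
apply: (le_trans (ler_sum _ (fun k _ => le k))).
rewrite -mulr_suml big_split /= -mulr_suml sumr_const card_ord.
rewrite -[c *+ n]mulr_natl ler_pdivrMr//.
have -> : n%:R * c * 2 = n%:R * c ^+ 2 / c + n%:R * c.
  by rewrite expr2 mulrA mulfK ?gt_eqF//; ring.
by rewrite lerD2r ler_wpM2r// invr_ge0 ltW.
Qed.

Lemma sum_lt_power_dist2 (R : realType) (X : Type) (rho : X -> X -> R) (n : nat)
    (x y : 'I_n -> X) (M c delta : R) :
  (forall a b, 0 <= rho a b <= M) -> (0 < n)%N -> 0 < delta -> 
  \sum_k rho (x k) (y k) <= n%:R * c -> M * c < delta ^+ 2 ->
  power_dist 2%:E rho x y < delta.
Proof.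
move=> rhoM n0 d0 le Mc; rewrite /power_dist.
have n0' : 0 < (n%:R : R) by rewrite ltr0n.
have [rho0 rhole] : (forall a b, 0 <= rho a b) /\ (forall a b, rho a b <= M).
  by split=> a b; case/andP: (rhoM a b).
have M0 : 0 <= M.
  exact: le_trans (rho0 (x (Ordinal n0)) (x (Ordinal n0))) (rhole _ _).
rewrite [ltRHS](_ : _ = (delta `^ 2) `^ 2^-1); last first.
  by rewrite -powRrM mulfV// powRr1// ltW.
rewrite gt0_ltr_powR ?nnegrE ?powR_ge0// ?invr_gt0//.
  by rewrite mulr_ge0// sumr_ge0// => k _; exact: powR_ge0.
rewrite powR_mulrn ?(ltW d0)//; apply: le_lt_trans Mc.
rewrite ler_pdivrMl// mulrCA.
apply: (@le_trans _ _ (M * \sum_k rho (x k) (y k))); last by rewrite ler_wpM2l.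
rewrite mulr_sumr; apply: ler_sum => k _.
by rewrite powR_mulrn// expr2 ler_wpM2r.
Qed.

Lemma near_forall_seq (T : eqType) (I : Type) (F : set_system I) (s : seq T)
    (P : T -> I -> Prop) : Filter F ->
  (forall t, t \in s -> \forall i \near F, P t i) ->
  \forall i \near F, forall t, t \in s -> P t i.
Proof.
move=> FF; elim: s => [_|a s IH H]; first exact: nearW.
have Ha := H a (mem_head _ _).
have Hs : \forall i \near F, forall t, t \in s -> P t i.
  by apply: IH => t ts; apply: H; rewrite inE ts orbT.
apply: filterS2 Ha Hs => i Pa Ps t; rewrite inE => /predU1P[->//|].
exact: Ps.
Qed.

Lemma sofic_near_morphism (R : realType) (G : groupType) (d : nat -> nat)
    (sigma : forall i, G -> 'S_(d i)) (g h : G) (kappa : R) :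
  sofic_approximation R sigma -> 0 < kappa ->
  \forall i \near \oo, #|[set k : 'I_(d i) |
     sigma i g (sigma i h k) != sigma i (g * h)%g k]%SET|%:R
       <= (d i)%:R * kappa :> R.
Proof.
move=> [_ /(_ g h) mor _] k0.
have : \forall i \near \oo, 1 - kappa < #|[set k : 'I_(d i) |
     sigma i g (sigma i h k) == sigma i (g * h)%g k]%SET|%:R / (d i)%:R :> R.
  by apply: (mor [set r | 1 - kappa < r]); apply: open_nbhs_nbhs; split;
    [exact: open_gt|rewrite /= ltrBlDr ltrDl].
apply: filterS => i.
set A := [set k | _ == _]%SET; set B := [set k | _]%SET.
have AB : #|A|%:R + #|B|%:R = (d i)%:R :> R.
  rewrite -natrD -(_ : ~: A = B)%SET ?cardsC ?card_ord//.
  by apply/setP => k; rewrite !inE.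
have [d0|d0] := posnP (d i).
  move=> _; have : #|B|%:R <= (d i)%:R :> R by rewrite -AB lerDr.
  have -> : (d i)%:R = 0 :> R by rewrite d0.
  by rewrite mul0r.
have d0' : 0 < ((d i)%:R : R) by rewrite ltr0n.
rewrite ltr_pdivlMr//; move: AB.
move: (#|A|%:R : R) (#|B|%:R : R) ((d i)%:R : R) => a b D AB.
by rewrite mulrBl mul1r (mulrC D); move: (kappa * D) => u; lra.
Qed.

Lemma sofic_degree_gt (R : realType) (G : groupType) (d : nat -> nat)
    (sigma : forall i, G -> 'S_(d i)) (m : nat) :
  sofic_approximation R sigma -> \forall i \near \oo, (m < d i)%N.
Proof.
by move=> [doo _ _]; apply: (doo [set k | (m < k)%N]); exists m.+1.
Qed.

Section MapEstimates.
Context (R : realType) (G : groupType) (X : topologicalType)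
  (act : G -> X -> X) (rho : X -> X -> R) (rhoP : pseudometric rho).

Lemma Map_almost_equivariant (F : set G) (delta : R) (n : nat) (s : G -> 'S_n)
    (phi : 'I_n -> X) (g : G) :
  (0 < n)%N -> 0 < delta -> Map act rho F delta s phi -> F g ->
  \sum_k rho (phi (s g k)) (act g (phi k)) <= n%:R * delta.
Proof.
have [rho0 _ _ _] := rhoP; move=> n0 d0 Mphi Fg.
by apply: power_dist2_lt_sum => //; exact: Mphi.
Qed.

(** Replace [g phi] and [g psi] by [phi o s g] and [psi o s g], at the cost of
    [n * delta] each; since [s g] is a permutation, the average distance between
    the latter is that of [phi] and [psi]. *)
Lemma Map_sum_dist (E : seq G) (F : set G) (delta : R) (n : nat)
    (s : G -> 'S_n) (phi psi : 'I_n -> X) (c : R) :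
  (0 < n)%N -> 0 < delta -> (forall g, g \in E -> F g) ->
  Map act rho F delta s phi -> Map act rho F delta s psi ->
  \sum_k rho (phi k) (psi k) <= n%:R * c ->
  \sum_k sum_dist act rho E (phi k) (psi k)
    <= (size E)%:R * (n%:R * (c + 2 * delta)).
Proof.
move=> n0 d0 EF Mphi Mpsi le; have [rho0 _ rhoC rhoD] := rhoP.
rewrite /sum_dist exchange_big /=.
apply: (@le_trans _ _ (\sum_(g <- E) n%:R * (c + 2 * delta))); last first.
  by rewrite big_const_seq count_predT iter_addr_0 -[leLHS]mulr_natl.
rewrite big_seq [leRHS]big_seq; apply: ler_sum => g gE.
have H1 := Map_almost_equivariant n0 d0 Mphi (EF _ gE).
have H2 := Map_almost_equivariant n0 d0 Mpsi (EF _ gE).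
have H3 : \sum_k rho (phi (s g k)) (psi (s g k)) <= n%:R * c.
  apply: le_trans le; rewrite [leRHS](reindex_inj (@perm_inj _ (s g))) /=.
  by [].
apply: (@le_trans _ _ (\sum_k (rho (phi (s g k)) (act g (phi k)) +
    (rho (phi (s g k)) (psi (s g k)) + rho (psi (s g k)) (act g (psi k)))))).
  apply: ler_sum => k _; rewrite (rhoC (phi (s g k)) (act g _)).
  by apply: le_trans (rhoD _ (phi (s g k)) _) _; rewrite lerD2l.
rewrite !big_split /=.
have -> : n%:R * (c + 2 * delta) = n%:R * delta + (n%:R * c + n%:R * delta).
  by ring.
by rewrite !lerD.
Qed.

(** Compare both sides through [phi (s g (s h k))] and [phi (s (g h) k)]; these
    agree except on the few points where [s] fails to be multiplicative at
    [(g, h)]. *)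
Lemma Map_almost_equivariant_mul (F : set G) (delta kappa M : R) (n : nat)
    (s : G -> 'S_n) (phi : 'I_n -> X) (g h : G) :
  (0 < n)%N -> 0 < delta -> (forall x y, rho x y <= M) ->
  (forall x, act (g * h)%g x = act g (act h x)) ->
  F g -> F (g * h)%g -> Map act rho F delta s phi ->
  #|[set k | s g (s h k) != s (g * h)%g k]%SET|%:R <= n%:R * kappa :> R ->
  \sum_k rho (act g (phi (s h k))) (act g (act h (phi k)))
    <= n%:R * (2 * delta + M * kappa).
Proof.
move=> n0 d0 rhoM actM Fg Fgh Mphi bad; have [rho0 rhoxx rhoC rhoD] := rhoP.
have M0 : 0 <= M.
  exact: le_trans (rho0 (phi (Ordinal n0)) (phi (Ordinal n0))) (rhoM _ _).
have H1 := Map_almost_equivariant n0 d0 Mphi Fg.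
have H2 := Map_almost_equivariant n0 d0 Mphi Fgh.
rewrite (reindex_inj (@perm_inj _ (s h))) /= in H1.
apply: (@le_trans _ _ (\sum_k (rho (phi (s g (s h k))) (act g (phi (s h k))) +
    (rho (phi (s g (s h k))) (phi (s (g * h)%g k)) +
     rho (phi (s (g * h)%g k)) (act (g * h)%g (phi k)))))).
  apply: ler_sum => k _; rewrite actM (rhoC (phi (s g (s h k))) (act g _)).
  by apply: le_trans (rhoD _ (phi (s g (s h k))) _) _; rewrite lerD2l.
rewrite !big_split /=.
have H3 : \sum_k rho (phi (s g (s h k))) (phi (s (g * h)%g k))
    <= M * (n%:R * kappa).
  apply: (@le_trans _ _
    (M * #|[set k | s g (s h k) != s (g * h)%g k]%SET|%:R)); last first.
    by rewrite ler_wpM2l.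
  rewrite mulr_natr -sumr_const [leRHS]big_mkcond /=; apply: ler_sum => k _.
  by rewrite inE; case: eqP => [->|_] //=; rewrite rhoxx.
have -> : n%:R * (2 * delta + M * kappa) =
    n%:R * delta + (M * (n%:R * kappa) + n%:R * delta).
  by ring.
by rewrite !lerD.
Qed.

End MapEstimates.

(** By [generating_controls], [tau <= c / 2 + L * sum_dist act rho E] for suitable
    [E] and [L].  So it suffices that [g phi (s h k)] and [g h phi k] be close in
    the average of [rho] for [g] in [E] and [h] in [F], which
    [Map_almost_equivariant_mul] gives once [E] and the products [g h] are
    in [F']. *)
Lemma Map_transfer (R : realType) (G : groupType) (X : topologicalType)
    (act : G -> X -> X) (d : nat -> nat) (sigma : forall i, G -> 'S_(d i))
    (rho tau : X -> X -> R) (F : set G) (delta : R) :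
  compact [set: X] -> action_by_homeos act -> sofic_approximation R sigma ->
  dyn_generating act rho -> continuous_pseudometric tau ->
  finite_set F -> 0 < delta ->
  exists (F' : set G) (delta' : R), [/\ finite_set F', 0 < delta' &
    \forall i \near \oo,
      Map act rho F' delta' (sigma i) `<=` Map act tau F delta (sigma i)].
Proof.
move=> cX [_ actM cact] sof grho ctau /finite_seqP[s ->] d0.
have [M M0 rhoM] := continuous_pseudometric_bounded cX grho.1.
have [N N0 tauN] := continuous_pseudometric_bounded cX ctau.
have [[prho _] _] := grho; have [rho0 _ _ _] := prho.
have [[tau0 _ _ _] _] := ctau.
pose c := delta ^+ 2 / (2 * N).
have c0 : 0 < c by rewrite divr_gt0 ?exprn_gt0// mulr_gt0.
have c02 : 0 < c / 2 by rewrite divr_gt0.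
have [E [th [th0 Eth]]] := generating_controls cX cact grho ctau c02.
pose L := N / th.
have L0 : 0 < L by rewrite divr_gt0.
have tauL x y : tau x y <= c / 2 + L * sum_dist act rho E x y.
  have D0 : 0 <= sum_dist act rho E x y by rewrite sumr_ge0.
  have [lt|] := boolP (all (fun g => rho (act g x) (act g y) < th) E).
    apply: le_trans (ltW (Eth x y _)) _; first by move=> g gE; exact: (allP lt).
    by rewrite lerDl mulr_ge0// ltW.
  move=> /allPn[g gE]; rewrite -leNgt => thg.
  apply: le_trans (tauN x y) _; rewrite ler_wpDl ?(ltW c02)//.
  rewrite /L mulrAC ler_pdivlMr// ler_wpM2l ?(ltW N0)//.
  by apply: le_trans thg _; exact: sum_dist_ge.
pose delta' := c / (6 * L * (size E).+1%:R).
have d0' : 0 < delta' by rewrite divr_gt0// mulr_gt0// mulr_gt0.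
exists [set` E ++ [seq (g * h)%g | g <- E, h <- s]], delta'; split => //.
have bad : \forall i \near \oo, forall g, g \in E -> forall h, h \in s ->
    #|[set k : 'I_(d i) |
        sigma i g (sigma i h k) != sigma i (g * h)%g k]%SET|%:R
      <= (d i)%:R * (delta' / M) :> R.
  apply: near_forall_seq => g gE; apply: near_forall_seq => h hs.
  by apply: sofic_near_morphism => //; rewrite divr_gt0.
apply: filterS2 (sofic_degree_gt 0 sof) bad => i di bad phi Mphi h hs.
apply: (@sum_lt_power_dist2 _ _ _ _ _ _ N c) => //.
- by move=> a b; rewrite tau0 tauN.
- apply: (le_trans (ler_sum _ (fun k _ => tauL _ _))).
  rewrite big_split /= sumr_const card_ord -mulr_sumr /sum_dist exchange_big /=.
  apply: (@le_trans _ _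
    ((c / 2) *+ d i + L * \sum_(g <- E) (d i)%:R * (3 * delta'))).
    rewrite lerD2l ler_wpM2l ?(ltW L0)// big_seq [leRHS]big_seq.
    apply: ler_sum => g gE.
    have -> : 3 * delta' = 2 * delta' + M * (delta' / M).
      by field; rewrite gt_eqF.
    apply: (Map_almost_equivariant_mul prho di d0' rhoM (actM g h) _ _ Mphi
      (bad g gE h hs)) => /=.
      by rewrite mem_cat gE.
    by rewrite mem_cat; apply/orP; right; apply/allpairsP; exists (g, h).
  rewrite big_const_seq count_predT iter_addr_0 -[c / 2 *+ _]mulr_natl
    -[(_ * (3 * _)) *+ _]mulr_natl.
  have small : L * ((size E)%:R * (3 * delta')) <= c / 2.
    have S0 : (size E).+1%:R != 0 :> R by rewrite pnatr_eq0.
    have -> : L * ((size E)%:R * (3 * delta')) =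
        c / 2 * ((size E)%:R / (size E).+1%:R).
      rewrite /delta'; move: (size E).+1%:R S0 => t t0.
      by field; rewrite t0 !gt_eqF.
    by rewrite ler_piMr ?(ltW c02)// ler_pdivrMr ?ltr0n// mul1r ler_nat.
  rewrite (_ : _ + _ = (d i)%:R * (c / 2 + L * ((size E)%:R * (3 * delta')))).
    by rewrite ler_wpM2l//; lra.
  by ring.
- have -> : N * c = delta ^+ 2 / 2 by rewrite /c; field; rewrite gt_eqF.
  by rewrite ltr_pdivrMr// ltr_pMr ?exprn_gt0// ltr1n.
Qed.

(** * From spanning sets to the mean dimension *)

Lemma power_dist1_sum (R : realType) (X : Type) (rho : X -> X -> R) (n : nat)
    (x y : 'I_n -> X) (c : R) :
  (forall a b, 0 <= rho a b) -> (0 < n)%N ->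
  power_dist 1%:E rho x y < c -> \sum_k rho (x k) (y k) <= n%:R * c.
Proof.
move=> rho0 n0; rewrite /power_dist invr1 powRr1; last first.
  by rewrite mulr_ge0// sumr_ge0// => k _; exact: powR_ge0.
rewrite ltr_pdivrMl ?ltr0n// => /ltW; apply: le_trans.
by apply: ler_sum => k _; rewrite powRr1.
Qed.

(** The points of the given [eps]-dense set [A] need not lie in
    [Map act rho F delta s], so they are replaced by elements of [Y] close to
    them, which doubles [eps]; almost equivariance then turns closeness for [rho]
    into closeness for [sum_dist], hence for the functions [w a]. *)
Lemma wdim_le_spanning (R : realType) (G : groupType) (X : topologicalType)
    (act : G -> X -> X) (n : nat) (s : G -> 'S_n) (rho tau : X -> X -> R)
    (E : seq G) (L : R) (l : nat) (w : 'I_l -> X -> R) (eps0 eps delta : R)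
    (F : set G) (Y : set {ptws 'I_n -> X}) (A : set {ptws 'I_n -> X})
    (N Q C m : nat) :
  pseudometric rho -> 0 < L -> 0 < eps0 -> 0 < delta -> (0 < n)%N ->
  (forall a, continuous (w a)) -> (forall a x, 0 <= w a x) ->
  (forall x, exists a, w a x = 1) ->
  (forall a x y, w a x = 1 -> 0 < w a y -> tau x y < eps0) ->
  (forall a x y, `|w a x - w a y| <= L * sum_dist act rho E x y) ->
  (forall g, g \in E -> F g) ->
  Y `<=` Map act rho F delta s -> Y !=set0 ->
  (A #= `I_N)%card ->
  (forall y, Y y -> exists2 a, A a & power_dist 1%:E rho y a < eps) ->
  (0 < C)%N -> (C.*2 <= Q)%N ->
  N%:R * 2 ^+ (l * n) < (Q%:R / C.*2%:R) ^+ m :> R ->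
  (wdim (fun x y : set_type Y => power_dist +oo%E tau (set_val x) (set_val y))
     eps0 <= (Num.truncn (m%:R + 2 * Q%:R *
       (l%:R * (L * ((size E)%:R * (n%:R * (eps + eps + 2 * delta)))))
         / C%:R))%:R%:E)%E.
Proof.
move=> prho L0 eps00 d0 n0 cw w0 w1 wsep wlip EF YM [phi0 Yphi0] AN cover.
move=> C0 CQ lt.
have [rho0 _ rhoC rhoD] := prho.
have [f [fA finj _]] := card_set_bijP AN.
pose reps (j : 'I_N) := [set psi | Y psi /\
   exists a, [/\ A a, f a = j & power_dist 1%:E rho psi a < eps]].
pose rep j := xget phi0 (reps j).
apply: (wdim_le_cover (c := fun j i => w i.1 (rep j i.2)) eps00 cw w0 w1 wsep
  _ C0 CQ lt).
move=> phi Yphi; have [a Aa phia] := cover _ Yphi.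
have aN : (f a < N)%N by exact: fA.
exists (Ordinal aN).
have [Yrep [a' [Aa' fa' repa']]] : reps (Ordinal aN) (rep (Ordinal aN)).
  apply: (@xgetPex _ phi0 (reps (Ordinal aN))); exists phi.
  by split=> //; exists a.
have aa' : a' = a by apply: finj => //; rewrite inE.
rewrite {a' fa' Aa'}aa' in repa'.
have D1 : \sum_k rho (phi k) (rep (Ordinal aN) k) <= n%:R * (eps + eps).
  rewrite mulrDr; apply: le_trans (lerD (power_dist1_sum rho0 n0 phia)
    (power_dist1_sum rho0 n0 repa')).
  rewrite -big_split /=; apply: ler_sum => k _.
  by rewrite (rhoC (rep _ k) (a k)) rhoD.
have D2 := Map_sum_dist prho n0 d0 EF (YM _ Yphi) (YM _ Yrep) D1.
rewrite -(pair_bigA _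
  (fun b k => `|w b (phi k) - w b (rep (Ordinal aN) k)|)) /=.
apply: (@le_trans _ _ (\sum_(b < l)
    L * \sum_k sum_dist act rho E (phi k) (rep (Ordinal aN) k))).
  apply: ler_sum => b _; rewrite mulr_sumr.
  by apply: ler_sum => k _; exact: wlip.
rewrite sumr_const card_ord -[leLHS]mulr_natl ler_wpM2l// ler_wpM2l//.
exact: ltW.
Qed.

Lemma spanning_number_lt (R : realType) (T : Type) (Y : set T)
    (dist : T -> T -> R) (eps a b : R) :
  0 < a -> (lne (spanning_number Y dist eps) * a^-1%:E < b%:E)%E ->
  exists (N : nat) (A : set T), [/\ N%:R < expR (b * a) :> R, (A #= `I_N)%card
    & forall y, Y y -> exists2 x, A x & dist y x < eps].
Proof.
move=> a0 lt.
have : (spanning_number Y dist eps < (expR (b * a))%:E)%E.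
  move: lt; case: (spanning_number _ _ _) => [r| |] /=.
  - case: ifPn => [r0 _|]; first by rewrite lte_fin (le_lt_trans r0)// expR_gt0.
    rewrite -ltNge => r0; rewrite -EFinM !lte_fin ltr_pdivrMr// => lt.
    by rewrite -[ltLHS]lnK ?posrE// ltr_expR.
  - by rewrite gt0_mulye ?lte_fin ?invr_gt0// ltNge leey.
  - by rewrite ltNyr.
move=> /ereal_inf_lt[_ [N [A [_ AN cov]] <-]]; rewrite lte_fin => Nlt.
by exists N, A.
Qed.

(** In logarithms: [D n Lam + l n ln 2 < m (Lam - ln B)] with [Lam = ln (1/eps)],
    which holds for [m > (D + tau) n] once [tau Lam] dominates the constants. *)
Lemma centers_lt_cells_power (R : realType) (N l n Q B m : nat)
    (D tau eps : R) :
  (0 < B)%N -> 0 < eps -> eps * B%:R <= 1 -> eps^-1 <= Q%:R ->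
  0 < D -> 0 < tau ->
  l%:R * ln 2 + (D + tau) * ln B%:R <= tau * ln eps^-1 ->
  (D + tau) * n%:R < m%:R -> N%:R < expR (D * (n%:R * ln eps^-1)) ->
  N%:R * 2 ^+ (l * n) < (Q%:R / B%:R) ^+ m :> R.
Proof.
move=> B0 e0 eB eQ D0 t0 small mlo Nup.
have B0' : 0 < (B%:R : R) by rewrite ltr0n.
pose Lam := ln eps^-1; pose b := ln (B%:R : R).
have ie0 : 0 < eps^-1 by rewrite invr_gt0.
have bL : b <= Lam.
  by rewrite /b /Lam ler_ln ?posrE// -[leRHS]mul1r ler_pdivlMr// mulrC.
have lnq : expR (Lam - b) <= Q%:R / B%:R.
  by rewrite expRD expRN !lnK ?posrE// ler_pM2r ?invr_gt0.
apply: (@lt_le_trans _ _ (expR (Lam - b) ^+ m)); last first.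
  by rewrite lerXn2r ?nnegrE ?expR_ge0// divr_ge0.
have -> : (2 : R) ^+ (l * n) = expR ((l * n)%:R * ln 2).
  by rewrite expRM_natl lnK ?posrE.
rewrite -expRM_natl.
apply: (@lt_le_trans _ _ (expR (D * (n%:R * Lam)) * expR ((l * n)%:R * ln 2))).
  by rewrite ltr_pM2r// expR_gt0.
rewrite -expRD ler_expR natrM.
have n0 : 0 <= (n%:R : R) by [].
apply: (@le_trans _ _ ((D + tau) * n%:R * (Lam - b))); last first.
  by rewrite ler_wpM2r ?subr_ge0// ltW.
move: small; rewrite -/Lam -/b => /(ler_wpM2l n0).
rewrite -subr_ge0 => small; rewrite -subr_ge0; apply: le_trans small _.
by rewrite le_eqVlt; apply/orP; left; apply/eqP; ring.
Qed.

Lemma lee_of_lt_fin (R : realType) (a b : \bar R) :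
  (forall D : R, (b < D%:E)%E -> (a <= D%:E)%E) -> (a <= b)%E.
Proof.
case: b => [b| |] H; last 2 first.
- by rewrite leey.
- by rewrite (@eq_ninfty _ a)// => D; apply: H; rewrite ltNyr.
apply/lee_addgt0Pr => e e0; rewrite -EFinD; apply: H.
by rewrite lte_fin ltrDl.
Qed.

Lemma limn_esup_le_near (R : realType) (u : (\bar R)^nat) (D : \bar R) :
  (\forall i \near \oo, (u i <= D)%E) -> (limn_esup u <= D)%E.
Proof.
move=> near; rewrite /limn_esup limf_esupE.
apply: (@le_trans _ _ (ereal_sup (u @` [set i | (u i <= D)%E]))).
  by apply: ereal_inf_lbound; exists [set i | (u i <= D)%E].
by apply: ge_ereal_sup => _ [i /= iD <-].
Qed.

Lemma limn_esup_lt_near (R : realType) (u : (\bar R)^nat) (D : \bar R) :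
  (limn_esup u < D)%E -> \forall i \near \oo, (u i < D)%E.
Proof.
rewrite /limn_esup limf_esupE => /ereal_inf_lt[_ [V oV <-]] VD.
apply: filterS oV => i Vi; apply: le_lt_trans VD.
by apply: ereal_sup_ubound; exists i.
Qed.

Lemma limf_einf_lt_exists (R : realType) (T : choiceType) (X : filteredType T)
    (f : X -> \bar R) (F : set_system X) (V : set X) (D : \bar R) :
  F V -> (limf_einf f F < D)%E -> exists2 x, V x & (f x < D)%E.
Proof.
rewrite limf_einfE => FV lt.
have /ereal_inf_lt[_ [x Vx <-] fx] : (ereal_inf (f @` V) < D)%E.
  by apply: le_lt_trans lt; apply: ereal_sup_ubound; exists V.
by exists x.
Qed.

Lemma near0_small_scale (R : realType) (K B : R) : 0 < B ->
  \forall eps \near (0 : R)^'+,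
    [/\ 0 < eps, eps < 1, eps * B <= 1 & K <= ln eps^-1].
Proof.
move=> B0; near=> eps.
have e0 : 0 < eps by near: eps; exact: nbhs_right_gt.
split=> //.
- rewrite -ler_pdivlMr// mul1r; near: eps.
  by apply: nbhs_right_le; rewrite invr_gt0.
- rewrite -[leLHS]expRK ler_ln ?posrE ?expR_gt0 ?invr_gt0//.
  rewrite -[leLHS]invrK lef_pV2 ?posrE ?invr_gt0 ?expR_gt0//.
  by near: eps; apply: nbhs_right_le; rewrite invr_gt0 expR_gt0.
Unshelve. all: by end_near. Qed.

Lemma Map_subset (R : realType) (G : groupType) (X : topologicalType)
    (act : G -> X -> X) (rho : X -> X -> R) (F F' : set G) (delta delta' : R)
    (n : nat) (s : G -> 'S_n) :
  F' `<=` F -> delta <= delta' ->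
  Map act rho F delta s `<=` Map act rho F' delta' s.
Proof. by move=> FF dd phi Mphi g Fg; apply: lt_le_trans dd; exact/Mphi/FF. Qed.

(** Let [D] bound the metric mean dimension of [rho2].  The constants [E], [L],
    [l] depend on [eps0] alone, and [C] is chosen so large that Markov's
    inequality loses at most [t * d_i] coordinates; then [eps] is taken small
    enough for [centers_lt_cells_power].  If [Map] is empty then [wdim = -oo];
    otherwise the [eps]-dense set is nonempty and [D > 0]. *)
Lemma mdim_le_mdim_metric1 (R : realType) (G : groupType) (X : topologicalType)
    (act : G -> X -> X) (d : nat -> nat) (sigma : forall i, G -> 'S_(d i))
    (rho tau rho2 : X -> X -> R) :
  compact [set: X] -> action_by_homeos act -> sofic_approximation R sigma ->
  dyn_generating act rho -> compatible_metric tau -> dyn_generating act rho2 ->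
  (mdim act sigma rho tau <= mdim_metric act sigma 1%:E rho2)%E.
Proof.
move=> cX hact sof grho ctau grho2; have [_ _ cact] := hact.
have [[prho2 _] _] := grho2; have [rho20 _ _ _] := prho2.
apply: lee_of_lt_fin => D ltD.
apply: ge_ereal_sup => _ [eps0 /= eps00 <-].
apply/lee_addgt0Pr => e e_gt0; pose t := e / 3.
have t0 : 0 < t by rewrite divr_gt0.
have [E [L [l [w [L0 cw w1 wsep wlip]]]]] :=
  separating_bumps cX cact grho2 (compatible_metric_continuous ctau) eps00.
(* [2 Q s / C <= t d_i] with [Q <= 2 / eps] and [s <= 4 eps l L |E| d_i], the
   total distance of the coordinates to those of a centre *)
pose c0 := 16 * l%:R * L * (size E)%:R.
pose C := (Num.truncn (c0 / t)).+1.
have Ct : c0 <= C%:R * t by rewrite -ler_pdivrMr// ltW// truncnS_gt.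
pose K := (l%:R * ln 2 + (`|D| + t) * ln C.*2%:R) / t.
have B0 : 0 < (C.*2%:R : R) by rewrite ltr0n double_gt0.
have [eps [eps_gt0 eps1 epsB epsK]] :=
  limf_einf_lt_exists (near0_small_scale K B0) ltD.
move=> /ereal_inf_lt[_ [[F1 d1] /= [finF1 d10] <-]] /limn_esup_lt_near spanD.
pose F := F1 `|` [set` E]; pose delta := Num.min d1 eps.
have delta0 : 0 < delta by rewrite lt_min d10.
have finF : finite_set F by rewrite finite_setU; split.
have [F' [d' [finF' d'0 sub]]] :=
  Map_transfer cX hact sof grho grho2.1 finF delta0.
apply: (@le_trans _ _ (limn_esup (fun i =>
    wdim (fun x y : set_type (Map act rho F' d' (sigma i)) =>
            power_dist +oo%E tau (set_val x) (set_val y)) eps0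
    * ((d i)%:R)^-1%:E)%E)).
  by apply: ereal_inf_lbound; exists (F', d').
apply: limn_esup_le_near.
have dbig := sofic_degree_gt (Num.truncn t^-1) sof.
apply: filterS3 dbig sub spanD => i dbig sub spanD.
have n0 : (0 < d i)%N by exact: leq_ltn_trans dbig.
have n0' : 0 < ((d i)%:R : R) by rewrite ltr0n.
have nt : 1 <= (d i)%:R * t.
  rewrite -ler_pdivrMr// mul1r ltW// (lt_le_trans (truncnS_gt _))//.
  by rewrite ler_nat.
have [Y0|/set0P Yn0] := eqVneq (Map act rho F' d' (sigma i)) set0.
  rewrite wdim_empty; last by move=> [x /set_mem]; rewrite Y0.
  by rewrite gt0_mulNye ?leNye// lte_fin invr_gt0.
have ln0 : 0 < ln eps^-1 by rewrite ln_gt0// invf_gt1.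
have [|N [A [Nup AN cov]]] := spanning_number_lt _ spanD.
  by rewrite mulr_gt0.
have YM1 : Map act rho F' d' (sigma i) `<=` Map act rho2 F1 d1 (sigma i).
  apply: subset_trans sub _; apply: Map_subset; first by move=> g; left.
  by rewrite /delta ge_min lexx.
(* a nonempty eps-dense set has at least one point *)
have D0 : 0 < D.
  have [phi Yphi] := Yn0; have [a Aa _] := cov _ (YM1 _ Yphi).
  have N1 : (1 <= N)%N.
    rewrite lt0n; apply/eqP => N0; move: AN; rewrite N0 II0 card_eq0.
    by move=> /eqP A0; rewrite A0 in Aa.
  have : 1 < expR (D * ((d i)%:R * ln eps^-1)).
    by apply: le_lt_trans Nup; rewrite ler1n.
  by rewrite expR_gt1 pmulr_lgt0// mulr_gt0.
pose m := (Num.truncn ((D + t) * (d i)%:R)).+1.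
pose Q := (Num.truncn eps^-1).+1.
have Qlo : eps^-1 <= Q%:R by rewrite ltW// truncnS_gt.
have Qup : Q%:R <= 2 / eps.
  rewrite /Q -natr1.
  have : (Num.truncn eps^-1)%:R <= eps^-1 by rewrite truncn_le// invr_ge0 ltW.
  have : 1 <= eps^-1 by rewrite invf_ge1// ltW.
  by rewrite mulrC; lra.
have CQ : (C.*2 <= Q)%N.
  rewrite -(ler_nat R) (le_trans _ Qlo)// -[leRHS]mul1r ler_pdivlMr//.
  by rewrite mulrC.
have lt : N%:R * 2 ^+ (l * d i) < (Q%:R / C.*2%:R) ^+ m :> R.
  apply: (@centers_lt_cells_power R N l (d i) Q C.*2 m D t eps) => //.
  - move: epsK; rewrite /K ler_pdivrMr// (ger0_norm (ltW D0)).
    by rewrite (mulrC _ t).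
  - exact: truncnS_gt.
have EF g : g \in E -> F g by right.
have H := wdim_le_spanning (A := A) prho2 L0 eps00 delta0 n0
  (fun a => (cw a).1) (fun a => (cw a).2) w1 wsep wlip EF sub Yn0 AN
  (fun y Yy => cov y (YM1 _ Yy)) (ltn0Sn _) CQ lt.
apply: le_trans (lee_wpmul2r _ H) _; first by rewrite lee_fin invr_ge0.
rewrite -EFinM -EFinD lee_fin ler_pdivrMr//.
pose u := eps + eps + 2 * delta; rewrite -/u.
have u0 : 0 <= u by rewrite !addr_ge0 ?mulr_ge0 ?(ltW eps_gt0) ?(ltW delta0).
have u4 : u <= 4 * eps.
  have : delta <= eps by rewrite /delta ge_min lexx orbT.
  by rewrite /u; lra.
set s := m%:R + _.
have s0 : 0 <= s.
  by rewrite /s addr_ge0// divr_ge0// !mulr_ge0// ltW.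
apply: (@le_trans _ _ s); first by rewrite truncn_le.
have mup : m%:R <= (D + t) * (d i)%:R + 1.
  rewrite /m -natr1 lerD2r truncn_le// mulr_ge0//.
  by rewrite addr_ge0 ?(ltW t0) ?(ltW D0).
have err : 2 * Q%:R * (l%:R * (L * ((size E)%:R * ((d i)%:R * u)))) / C%:R
    <= t * (d i)%:R.
  rewrite ler_pdivrMr ?ltr0n//.
  apply: (@le_trans _ _ (c0 * (d i)%:R)); last first.
    by rewrite [leRHS]mulrAC ler_wpM2r// mulrC.
  have cst0 : 0 <= l%:R * L * (size E)%:R * (d i)%:R.
    by rewrite !mulr_ge0// ltW.
  have Qu : Q%:R * u <= 8.
    have -> : 8 = 2 / eps * (4 * eps) :> R by field; rewrite gt_eqF.
    by rewrite ler_pM.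
  have := ler_wpM2l cst0 Qu; rewrite /c0 -subr_ge0 => Hq.
  rewrite -subr_ge0; have -> : 16 * l%:R * L * (size E)%:R * (d i)%:R -
      2 * Q%:R * (l%:R * (L * ((size E)%:R * ((d i)%:R * u)))) =
    2 * (l%:R * L * (size E)%:R * (d i)%:R * 8 -
         l%:R * L * (size E)%:R * (d i)%:R * (Q%:R * u)) by ring.
  by rewrite mulr_ge0.
have e3 : e = 3 * t by rewrite /t; field.
rewrite e3; apply: (@le_trans _ _ ((D + t) * (d i)%:R + 1 + t * (d i)%:R)).
  by rewrite /s lerD.
have -> : (D + 3 * t) * (d i)%:R = (D + t) * (d i)%:R + 2 * (t * (d i)%:R).
  by ring.
by move: nt; rewrite (mulrC _ t); lra.
Qed.

(** * Monotonicity in the exponent *)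

(** With [t = s / r] and [c] the [r]-th power of the right-hand side, Young's
    inequality for [u^r / c] and [1] with exponents [t] and its conjugate reads
    [u^r / c <= (u^r / c)^t / t + 1 - 1/t]; the average of the right-hand side
    is [1]. *)
Lemma power_mean_le (R : realType) (n : nat) (u : 'I_n -> R) (r s : R) :
  (forall k, 0 <= u k) -> 0 < r -> r <= s ->
  (n%:R^-1 * \sum_k u k `^ r) `^ r^-1 <= (n%:R^-1 * \sum_k u k `^ s) `^ s^-1.
Proof.
move=> u0 r0; rewrite le_eqVlt => /predU1P[<-//|rs].
have s0 : 0 < s := lt_trans r0 rs.
case: n u u0 => [u _|n u u0].
  by rewrite !big_ord0 mulr0 powR0 ?powR_ge0// gt_eqF// invr_gt0.
have n0 : 0 < (n.+1%:R : R) by rewrite ltr0n.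
set A := n.+1%:R^-1 * \sum_k u k `^ s.
have A0 : 0 <= A by rewrite mulr_ge0// sumr_ge0// => k _; exact: powR_ge0.
have Ar0 : 0 <= n.+1%:R^-1 * \sum_k u k `^ r.
  by rewrite mulr_ge0// sumr_ge0// => k _; exact: powR_ge0.
pose t := s / r; pose c := A `^ t^-1.
have t0 : 0 < t by rewrite divr_gt0.
have t1 : t^-1 < 1 by rewrite invf_lt1// ltr_pdivlMr// mul1r.
suff le : n.+1%:R^-1 * \sum_k u k `^ r <= c.
  have -> : A `^ s^-1 = c `^ r^-1.
    by rewrite /c -powRrM /t; congr (_ `^ _); field; rewrite !gt_eqF.
  by rewrite ge0_ler_powR ?nnegrE ?powR_ge0// invr_ge0 ltW.
move: (A0); rewrite le_eqVlt => /predU1P[A00|Agt].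
  have us k : u k `^ s = 0.
    have : \sum_k u k `^ s = 0.
      by move/esym/eqP: A00; rewrite mulf_eq0 invr_eq0 pnatr_eq0 => /eqP.
    move=> /eqP; rewrite psumr_eq0 => [/allP/(_ k)|i _]; last exact: powR_ge0.
    by rewrite mem_index_enum => /(_ isT) /eqP.
  rewrite big1 ?mulr0 ?powR_ge0// => k _.
  have /eqP := us k; rewrite powR_eq0 => /andP[/eqP -> _].
  by rewrite powR0// gt_eqF.
have c0 : 0 < c by rewrite powR_gt0.
have ct : c `^ t = A by rewrite -powRrM mulVf ?powRr1// gt_eqF.
pose t' := (1 - t^-1)^-1.
have t'0 : 0 < t' by rewrite invr_gt0 subr_gt0.
have young k : u k `^ r <= c * (u k `^ s / A / t + (1 - t^-1)).
  rewrite -ler_pdivrMl// mulrC.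
  have := @conjugate_powR R (u k `^ r / c) 1 t t' _ ler01 t0 t'0.
  rewrite mulr1 powR1 /t' invrK addrCA subrr addr0 mul1r => /(_ _ erefl).
  have -> : (u k `^ r / c) `^ t = u k `^ s / A.
    rewrite powRM ?powR_ge0 ?invr_ge0 ?(ltW c0)// -powRrM; congr (_ `^ _ * _).
      by rewrite /t; field; rewrite gt_eqF.
    by rewrite -(powR_inv1 (ltW c0)) -powRrM mulrC powRrM ct powR_inv1.
  by apply; rewrite divr_ge0 ?powR_ge0// ltW.
rewrite ler_pdivrMl//.
apply: (le_trans (ler_sum _ (fun k _ => young k))).
rewrite -mulr_sumr big_split /= -!mulr_suml sumr_const card_ord.
have -> : \sum_k u k `^ s = n.+1%:R * A by rewrite /A mulVKf// gt_eqF.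
rewrite -[(1 - _) *+ _]mulr_natl le_eqVlt; apply/orP; left; apply/eqP.
by field; rewrite !gt_eqF.
Qed.

Lemma power_mean_le_max (R : realType) (n : nat) (u : 'I_n -> R) (r : R) :
  (forall k, 0 <= u k) -> 0 < r ->
  (n%:R^-1 * \sum_k u k `^ r) `^ r^-1 <= \big[Num.max/0]_k u k.
Proof.
move=> u0 r0; set M := \big[Num.max/0]_k u k.
have M0 : 0 <= M by exact: bigmax_ge_id.
case: (posnP n) => [n0|n0].
  move: u @M u0 M0; rewrite n0 => u M u0 M0.
  by rewrite !big_ord0 mulr0 powR0 ?gt_eqF// invr_gt0.
rewrite [leRHS](_ : _ = (M `^ r) `^ r^-1); last first.
  by rewrite -powRrM mulfV ?powRr1// gt_eqF.
have S0 : 0 <= n%:R^-1 * \sum_k u k `^ r.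
  by rewrite mulr_ge0// sumr_ge0// => k _; exact: powR_ge0.
rewrite ge0_ler_powR ?nnegrE ?powR_ge0 ?invr_ge0 ?(ltW r0)//.
rewrite ler_pdivrMl ?ltr0n// mulr_natl -[n in _ *+ n]card_ord -sumr_const.
apply: ler_sum => k _.
by rewrite ge0_ler_powR ?nnegrE ?(ltW r0)//; exact: le_bigmax.
Qed.

Lemma power_dist_le (R : realType) (X : Type) (rho : X -> X -> R) (p q : \bar R)
    (k : nat) (x y : 'I_k -> X) :
  (forall a b, 0 <= rho a b) -> (1 <= p)%E -> (p <= q)%E ->
  power_dist p rho x y <= power_dist q rho x y.
Proof.
move=> rho0; case: p => [r| |]; case: q => [s| |].
- rewrite !lee_fin => r1 rs.
  exact: power_mean_le (fun j => rho0 _ _) (lt_le_trans ltr01 r1) rs.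
- rewrite lee_fin => r1 _.
  exact: power_mean_le_max (fun j => rho0 _ _) (lt_le_trans ltr01 r1).
- by move=> _; rewrite leeNy_eq.
- by move=> _; rewrite leye_eq.
- by [].
- by move=> _; rewrite leye_eq.
- by rewrite leeNy_eq.
- by rewrite leeNy_eq.
- by [].
Qed.

Lemma spanning_number_ge0 (R : realType) (T : Type) (Y : set T)
    (dist : T -> T -> R) (eps : R) : (0 <= spanning_number Y dist eps)%E.
Proof. by apply: le_ereal_inf_tmp => _ [n _ <-]; rewrite lee_fin. Qed.

Lemma spanning_number_le (R : realType) (T : Type) (Y : set T)
    (dist dist' : T -> T -> R) (eps : R) :
  (forall x y, dist x y <= dist' x y) ->
  (spanning_number Y dist eps <= spanning_number Y dist' eps)%E.
Proof.
move=> le; apply: ereal_inf_le_tmp => _ [n [A [AY An cov]] <-].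
exists n => //; exists A; split=> // y /cov[a Aa ya].
by exists a => //; exact: le_lt_trans ya.
Qed.

Lemma limn_esup_le_all (R : realType) (u v : (\bar R)^nat) :
  (forall i, (u i <= v i)%E) -> (limn_esup u <= limn_esup v)%E.
Proof.
move=> uv; rewrite /limn_esup !limf_esupE.
apply: le_ereal_inf_tmp => _ [V FV <-].
apply: (@le_trans _ _ (ereal_sup (u @` V))).
  by apply: ereal_inf_lbound; exists V.
apply: ge_ereal_sup => _ [i Vi <-]; apply: le_trans (uv i) _.
by apply: ereal_sup_ubound; exists i.
Qed.

Lemma limf_einf_le_near (R : realType) (T : choiceType) (X : filteredType T)
    (F : set_system X) (f g : X -> \bar R) : Filter F ->
  (\forall x \near F, (f x <= g x)%E) -> (limf_einf f F <= limf_einf g F)%E.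
Proof.
move=> FF fg; rewrite !limf_einfE; apply: ge_ereal_sup => _ [V FV <-].
pose W := V `&` [set x | (f x <= g x)%E].
apply: (@le_trans _ _ (ereal_inf (g @` W))); last first.
  by apply: ereal_sup_ubound; exists W => //; exact: filterI.
apply: le_ereal_inf_tmp => _ [x [Vx fgx] <-]; apply: le_trans fgx.
by apply: ereal_inf_lbound; exists x.
Qed.

Lemma mdim_metric_le (R : realType) (G : groupType) (X : topologicalType)
    (act : G -> X -> X) (d : nat -> nat) (sigma : forall i, G -> 'S_(d i))
    (p q : \bar R) (rho : X -> X -> R) :
  pseudometric rho -> (1 <= p)%E -> (p <= q)%E ->
  (mdim_metric act sigma p rho <= mdim_metric act sigma q rho)%E.
Proof.
move=> [rho0 _ _ _] p1 pq; apply: limf_einf_le_near.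
apply: filterS (near0_small_scale 0 ltr01) => eps [eps0 eps1 _ ln0].
apply: le_ereal_inf_tmp => _ [[F delta] Fd <-].
apply: (@le_trans _ _ (limn_esup (fun i =>
    lne (spanning_number (Map act rho F delta (sigma i)) (power_dist p rho) eps)
      * ((d i)%:R * ln eps^-1)^-1%:E)%E)).
  by apply: ereal_inf_lbound; exists (F, delta).
apply: limn_esup_le_all => i; apply: lee_wpmul2r.
  by rewrite lee_fin invr_ge0 mulr_ge0.
rewrite lee_lne ?in_itv /= ?spanning_number_ge0 ?leey//.
by apply: spanning_number_le => x y; exact: power_dist_le.
Qed.

Theorem corollary2p19 (R : realType) (G : groupType) (X : topologicalType)
    (act : G -> X -> X) (d : nat -> nat) (sigma : forall i, G -> 'S_(d i))
    (p q : \bar R)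
    (G_countable : countable [set: G]) (G_sofic : sofic R G)
    (X_compact : compact [set: X]) (X_metrizable : metrizable R X)
    (act_homeo : action_by_homeos act)
    (sigma_sofic : sofic_approximation R sigma)
    (p_ge1 : (1 <= p)%E) (p_le_q : (p <= q)%E) :
  (forall rho rho' : X -> X -> R,
     dyn_generating act rho -> compatible_metric rho' ->
     (mdim act sigma rho rho' <= mdim_M act sigma p)%E) /\
  (mdim_M act sigma p <= mdim_M act sigma q)%E.
Proof.
split=> [rho rho' grho crho'|].
  apply: le_ereal_inf_tmp => _ [rho2 grho2 <-].
  apply: (@le_trans _ _ (mdim_metric act sigma 1%:E rho2)).
    exact: mdim_le_mdim_metric1.
  by apply: mdim_metric_le => //; exact: grho2.1.1.
apply: le_ereal_inf_tmp => _ [rho grho <-].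
apply: (@le_trans _ _ (mdim_metric act sigma p rho)).
  by apply: ereal_inf_lbound; exists rho.
by apply: mdim_metric_le => //; exact: grho.1.1.
Qed.
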